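(* Let $E$ be a non-trivial metrizable locally convex space, $X$ a Tychonoff space, and let $H$ be a subspace of $B(X,E)$ containing $B_1^{st,rc}(X,E)$. Then: (A) The following assertions are equivalent: (i) $H$ is metrizable; (ii) $H$ is a $\sigma$-space; (iii) $H$ has countable $cs^\ast$-character; (iv) $X$ is countable. (B) The following assertions are equivalent: (i) $H$ is a Fréchet–Urysohn space; (ii) $H$ is a sequential space; (iii) $H$ is a $k$-space; (iv) $H$ has countable tightness; (v) $X_{\aleph_0}$ satisfies the property $\gamma$.
   Context: $B_0(X,E)=C(X,E)$ is the set of continuous functions; for a nonzero countable ordinal $\alpha$, $B_\alpha(X,E)$ is the set of functions $X\to E$ that are pointwise limits of sequences from $\bigcup_{\beta<\alpha}B_\beta(X,E)$; $B(X,E)=\bigcup_{\alpha<\omega_1}B_\alpha(X,E)$. $B_1^{st}(X,E)$ is the set of all $f:X\to E$ for which there is a sequence $\{f_n\}$ in $C(X,E)$ stably converging to $f$, i.e. for every $x\in X$ the set $\{n: f_n(x)\ne f(x)\}$ is finite. $B_1^{st,rc}(X,E)$ is the set of all $f\in B_1^{st}(X,E)$ whose image $f(X)$ is relatively compact in $E$. All these sets carry the topology of pointwise convergence inherited from $E^X$. $X_{\aleph_0}$ is the set $X$ with the Baire topology, whose base is the family of all zero-sets $f^{-1}(0)$, $f:X\to\mathbb R$ continuous. A family $\gamma$ of subsets of a space $Z$ is an $\omega$-cover if every finite subset of $Z$ is contained in some member of $\gamma$. $Z$ has the property $\gamma$ if for every open $\omega$-cover there is a sequence $\{U_n\}_{n\in\omega}$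 of its members with $\bigcup_{n}\bigcap_{i\ge n}U_i=Z$. A family $\mathcal N$ of subsets of a space $Z$ is a network if for each $z\in Z$ and each neighborhood $O$ of $z$ there is $N\in\mathcal N$ with $z\in N\subseteq O$. $Z$ is a $\sigma$-space if it has a $\sigma$-locally finite network (a network that is a countable union of locally finite families). A family $\mathcal N$ is a $cs^\ast$-network at $z\in Z$ if for each sequence $(z_n)$ converging to $z$ and each neighborhood $O$ of $z$ there is $N\in\mathcal N$ with $z\in N\subseteq O$ and $\{n: z_n\in N\}$ infinite. $Z$ has countable $cs^\ast$-character if it has a countable $cs^\ast$-network at each point. A space is Fréchet–Urysohn if whenever $a\in\overline A$ there is a sequence in $A$ converging to $a$; sequential if for each non-closed $A$ there is a sequence in $A$ converging to a point of $\overline A\setminus A$; a $k$-space if for each non-closed $A$ there is a compact $K$ such that $A\cap K$ is not closed in $K$; of countable tightness if whenever $a\in\overline A$ there is a countable $B\subseteq A$ with $a\in\overline B$. *)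

(* Defs.v *)
From HB Require Import structures.
From mathcomp Require Import all_boot all_order all_algebra.
From mathcomp Require Import all_classical all_reals all_analysis.
From mathcomp Require Import wochoice complex.

Set Implicit Arguments.
Unset Strict Implicit.
Unset Printing Implicit Defensive.

Import Order.TTheory GRing.Theory Num.Theory.
Import numFieldTopology.Exports numFieldNormedType.Exports.

Local Open Scope classical_set_scope.
Local Open Scope ring_scope.

(* Locally convex spaces are taken over the reals ([c = false]) or over the
   complex numbers ([c = true]). *)
Definition scalar_field (R : realType) (c : bool) : numFieldType :=
  if c then (R[i] : numFieldType) else (R : numFieldType).

Section Spaces.
Variable Z : topologicalType.
Implicit Types (z : Z) (A : set Z) (N : set_system Z).

Definition metrizable (R : realType) : Prop :=
  exists d : Z -> Z -> R,
    [/\ forall x y, d x y = 0 <-> x = y,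
        forall x y, d x y = d y x,
        forall x y z, d x z <= d x y + d y z &
        forall x, nbhs x =
          filter_from [set e : R | 0 < e] (fun e => [set y | d x y < e])].

Definition tychonoff_space : Prop :=
  hausdorff_space Z /\ completely_regular_space Z.

Definition network N : Prop :=
  forall z (O : set Z), nbhs z O -> exists2 M, N M & M z /\ M `<=` O.

Definition locally_finite N : Prop :=
  forall z, exists2 O : set Z,
    nbhs z O & finite_set (N `&` [set M | M `&` O !=set0]).

Definition sigma_space : Prop :=
  exists N : nat -> set_system Z,
    (forall n, locally_finite (N n)) /\ network (\bigcup_n N n).

Definition cs_star_network_at z N : Prop :=
  forall (u : nat -> Z) (O : set Z), u @ \oo --> z -> nbhs z O ->
    exists2 M, N M & [/\ M z, M `<=` O & infinite_set [set n | M (u n)]].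

Definition countable_cs_star_character : Prop :=
  forall z, exists2 N, countable N & cs_star_network_at z N.

Definition frechet_urysohn_space : Prop :=
  forall A z, closure A z ->
    exists2 u : nat -> Z, (forall n, A (u n)) & u @ \oo --> z.

Definition sequential_space : Prop :=
  forall A, ~ closed A ->
    exists (u : nat -> Z) z,
      [/\ forall n, A (u n), u @ \oo --> z & (closure A `\` A) z].

Definition k_space : Prop :=
  forall A, ~ closed A ->
    exists2 K, compact K & ~ exists2 C, closed C & A `&` K = C `&` K.

Definition countable_tightness : Prop :=
  forall A z, closure A z -> exists B, [/\ B `<=` A, countable B & closure B z].

Definition omega_cover N : Prop :=
  forall F, finite_set F -> exists2 U, N U & F `<=` U.

Definition gamma_property : Prop :=
  forall N, N `<=` open -> omega_cover N ->
    exists2 U : nat -> set Z, (forall n, N (U n)) &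
      \bigcup_n \bigcap_(i in [set i | (n <= i)%N]) U i = [set: Z].

End Spaces.

Section BaireFunctions.
Variables X E : topologicalType.

(* [baire_class le a] is the class of index the order type of the set of strict
   predecessors of [a] in the well-order [le]. *)
Inductive baire_class (I : eqType) (le : rel I) : I -> (X -> E) -> Prop :=
| baire_class_continuous a f :
    (forall b, le a b) -> continuous f -> baire_class le a f
| baire_class_limit a f (b : nat -> I) (u : nat -> X -> E) :
    (forall n, le (b n) a && (b n != a)) ->
    (forall n, baire_class le (b n) (u n)) ->
    (forall x, u n x @[n --> \oo] --> f x) ->
    baire_class le a f.

(* Each countable ordinal is the order type of the strict predecessors of some
   point of a countable well-order, and conversely. *)
Definition baire_functions : set (X -> E) :=
  [set f | exists (I : countType) (le : rel I),
     well_order le /\ exists a, baire_class le a f].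

Definition stable_baire1 : set (X -> E) :=
  [set f | exists2 u : nat -> X -> E, (forall n, continuous (u n)) &
     forall x, finite_set [set n | u n x <> f x]].

Definition stable_baire1_rc : set (X -> E) :=
  stable_baire1 `&` [set f | precompact (range f)].

End BaireFunctions.

Definition baire_space (R : realType) (X : topologicalType) : Type := X.

Section BaireTopology.
Variables (R : realType) (X : topologicalType).

Definition zero_sets : set_system X :=
  [set A | exists2 f : X -> R, continuous f & A = f @^-1` [set 0]].

Local Notation T := (baire_space R X).

HB.instance Definition _ := Choice.copy T X.

Let zero_sets_cover : \bigcup_(A in zero_sets) A = [set: T].
Proof.
rewrite -subTset => x _; exists setT => //.
exists (fun=> 0); first exact: cst_continuous.
by rewrite predeqE => y; split.
Qed.

Let zero_sets_join (A B : set X) (t : T) :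
  zero_sets A -> zero_sets B -> A t -> B t ->
  exists C, [/\ zero_sets C, C t & C `<=` A `&` B].
Proof.
move=> [f cf ->] [g cg ->] ft gt.
exists ((fun x => `|f x| + `|g x|) @^-1` [set 0]); split.
- exists (fun x => `|f x| + `|g x|) => // x.
  by apply: cvgD; apply: cvg_norm; [exact: cf|exact: cg].
- by move: ft gt; rewrite /= => -> ->; rewrite normr0 addr0.
- move=> x /= /eqP; rewrite paddr_eq0 ?normr_ge0 // !normr_eq0.
  by case/andP => /eqP -> /eqP ->.
Qed.

HB.instance Definition _ :=
  isBaseTopological.Build T zero_sets_cover zero_sets_join.

End BaireTopology.

(* Main.v *)
Require Import Defs.
From mathcomp Require Import all_boot all_order all_algebra.
From mathcomp Require Import all_classical all_reals all_analysis.
From mathcomp Require Import wochoice complex.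
From mathcomp Require Import lra.

(** The two halves of the theorem rest on the same two facts. First, a Baire
    function [h] is locally constant for the Baire topology: every point lies in a
    zero-set on which [h] is constant ([baire_function_fibre]), because zero-sets
    are closed under countable intersections. Secondly, for a zero-set [A] of [X]
    and a fixed ray t |-> t v of [E], the function with value a v on [A] and b v
    off [A] has a finite range and is a stable limit of continuous functions
    ([two_valued_stable]), so it belongs to [H]. Zero-sets thus serve as clopen
    sets of the Baire topology, and [H] both sees them and sees nothing finer.

    (A) If [X] is countable then [H] lies in a countable power of a metric space.
    A metrizable space is a sigma-space: well-ordering its points turns the balls
    of a given radius into a partition whose pieces, once shrunk, are uniformly
    separated. In a Hausdorff sigma-space the points are G_delta, so the constant 0
    is determined in [H] by countably many coordinates; two-valued functions that
    vanish on a given countable set then force [X] to be countable. A countable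
    cs*-network leads to the same conclusion: otherwise a sequence of two-valued
    functions with pairwise disjoint supports converges to a constant, but
    eventually leaves every member of the network that stays near this constant at
    infinitely many coordinates.

    (B) The pivot is the property that every omega-cover open in the Baire topology
    has a countable omega-subcover. It makes a countable family of Baire functions
    factor through a countable quotient of [X]
    ([omega_subcovers_representatives]). On a countable quotient a diagonal choice
    produces the sequences required by the property gamma and by the
    Frechet-Urysohn property. Countable tightness gives back the pivot, since an
    omega-cover translates into two-valued functions accumulating at a constant.

    The remaining implication is that a k-space [H] has the pivot. For an index n
    take functions with value (n+2)^-1 v on a low set subject to some condition and
    (n+2) v elsewhere: the small value keeps 0 out of each of these layers, while the
    large one prevents a compact set from meeting infinitely many of them unless the
    low sets eventually catch every point ([k_space_layers]). If the layers are
    closed, the k-property therefore produces such a sequence of low sets. Applied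
    to low sets on which a locally constant function of m variables takes at most n
    values, this shows that such functions have only countably many values
    ([k_space_countable_values]). Now suppose that an omega-cover has no countable
    subfamily containing all sets of m points, and use low sets for which there is
    such a subfamily. The first alternative of [k_space_layers] is excluded, so some
    layer has a limit point outside it in a compact set. A recursion
    along the countable ordinals around this limit point yields, through a cluster
    point, a locally constant function of m variables with uncountably many values
    ([uncovered_limit_not_k_space]), a contradiction. *)

Set Implicit Arguments.
Unset Strict Implicit.
Unset Printing Implicit Defensive.

Import Order.TTheory GRing.Theory Num.Theory.
Import numFieldTopology.Exports numFieldNormedType.Exports.

Local Open Scope classical_set_scope.
Local Open Scope ring_scope.

(** * General topology *)

Lemma invS_small (R : realType) (e : R) : 0 < e ->
  exists N, forall n, (N <= n)%N -> n.+1%:R^-1 < e.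
Proof.
move=> e0; have [N _ HN] := near_infty_natSinv_lt (PosNum e0).
by exists N => n Nn; apply: (HN n).
Qed.

Lemma infinite_tail (A : set nat) N :
  (forall n, (N <= n)%N -> A n) -> infinite_set A.
Proof.
move=> NA finA; apply: infinite_nat.
suff -> : [set: nat] = `I_N `|` A by rewrite finite_setU; split.
apply/seteqP; split=> // n _.
by have [Nn|nN] := leqP N n; [right; exact: NA|left].
Qed.

Lemma countable_range_nat (T : Type) (A : set T) :
  countable A -> A !=set0 -> exists2 u : nat -> T, (forall n, A (u n)) &
  forall x, A x -> exists n, u n = x.
Proof.
move=> /countable_injP[f finj] [x0 Ax0].
have {}finj : forall x y, A x -> A y -> f x = f y -> x = y.
  by move=> x y Ax Ay; apply: finj; apply/mem_set.
have H n : exists x, A x /\ ((exists2 y, A y & f y = n) -> f x = n).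
  have [[y Ay fy]|H] := pselect (exists2 y, A y & f y = n).
    by exists y.
  by exists x0; split.
have [u Hu] := choice H.
exists u => [n|x Ax]; first by case: (Hu n).
exists (f x); have [Au fu] := Hu (f x).
by apply: finj => //; apply: fu; exists x.
Qed.

Section Metric.
Variables (R : realType) (Z : topologicalType).

Definition metrizes (d : Z -> Z -> R) :=
  [/\ forall x y, d x y = 0 <-> x = y,
      forall x y, d x y = d y x,
      forall x y z, d x z <= d x y + d y z &
      forall x, nbhs x =
        filter_from [set e : R | 0 < e] (fun e => [set y | d x y < e])].

Variable d : Z -> Z -> R.
Hypothesis dZ : metrizes d.

Lemma dist_eq0 x y : d x y = 0 -> x = y.
Proof. by case: dZ => h _ _ _ /h. Qed.

Lemma distxx x : d x x = 0.
Proof. by case: dZ => h _ _ _; apply/h. Qed.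

Lemma distC x y : d x y = d y x.
Proof. by case: dZ. Qed.

Lemma dist_triangle y x z : d x z <= d x y + d y z.
Proof. by case: dZ. Qed.

Lemma dist_ge0 x y : 0 <= d x y.
Proof. by have := dist_triangle y x x; rewrite distxx (distC y x); lra. Qed.

Lemma dist_gt0 x y : x <> y -> 0 < d x y.
Proof.
move=> xy; rewrite lt_neqAle dist_ge0 andbT eq_sym.
by apply/eqP => /dist_eq0.
Qed.

Lemma nbhs_dist x (A : set Z) :
  nbhs x A <-> exists2 e, 0 < e & forall y, d x y < e -> A y.
Proof.
by case: dZ => _ _ _ ->; split=> -[e e0 eA]; exists e.
Qed.

Lemma nbhs_ball_dist x e : 0 < e -> nbhs x [set y | d x y < e].
Proof. by move=> e0; apply/nbhs_dist; exists e. Qed.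

Lemma cvg_dist (u : nat -> Z) (z : Z) : u @ \oo --> z <->
  forall e, 0 < e -> exists N, forall n, (N <= n)%N -> d z (u n) < e.
Proof.
split=> [uz e e0|H].
  have [N _ HN] := uz _ (nbhs_ball_dist z e0).
  by exists N => n Nn; apply: (HN n).
move=> A /nbhs_dist[e e0 eA]; have [N HN] := H e e0.
by exists N => // n /= Nn; apply: eA; apply: HN.
Qed.

Lemma cvg_dist_unique (u : nat -> Z) (y z : Z) :
  u @ \oo --> y -> u @ \oo --> z -> y = z.
Proof.
move=> /cvg_dist uy /cvg_dist uz; apply: contrapT => yz.
have e0 : 0 < d y z / 2 by have := dist_gt0 yz; lra.
have [N HN] := uy _ e0; have [M HM] := uz _ e0.
have h1 := HN _ (leq_maxl N M); have h2 := HM _ (leq_maxr N M).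
by have := dist_triangle (u (maxn N M)) y z; rewrite (distC (u _) z); lra.
Qed.

Lemma metrizes_hausdorff : hausdorff_space Z.
Proof.
move=> x y xy; apply: contrapT => /dist_gt0 xy0.
have e0 : 0 < d x y / 2 by rewrite divr_gt0.
have [z [/= xz yz]] := xy _ _ (nbhs_ball_dist x e0) (nbhs_ball_dist y e0).
by have := dist_triangle z x y; rewrite (distC z y); lra.
Qed.

(** Well-order the points and assign each point to the first ball of radius r n
    that contains it. The pieces of this partition become uniformly separated when
    restricted to the points that are r k-deep in their ball, and every point is
    deep for some k. *)
Lemma metrizable_sigma_space : sigma_space Z.
Proof.
have [W Wwo] := well_ordering_principle Z.
have Wmin (A : set Z) : A !=set0 -> exists z, A z /\ forall y, A y -> W z y.
  move=> [z0 Az0].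
  have [z [[zA lbz] _]] : exists! z, minimum_of W (mem A) z.
    by apply: Wwo; exists z0; exact/mem_set.
  exists z; split; first exact/set_mem.
  by move=> y Ay; apply: lbz; exact/mem_set.
have Wanti x y : W x y -> W y x -> x = y.
  move=> xy yx.
  pose A : set Z := [set x; y].
  have [z [_ uz]] : exists! z, minimum_of W (mem A) z.
    by apply: Wwo; exists x; apply/mem_set; left.
  have Wxx t : W t t.
    have [s [[/set_mem /= sA lbs] _]] : exists! s, minimum_of W (mem [set t]) s.
      by apply: Wwo; exists t; apply/mem_set.
    by rewrite -{1}sA; apply: lbs; exact/mem_set.
  rewrite -(uz x); last first.
    by split; [apply/mem_set; left|move=> t /set_mem[->|->]].
  by apply: uz; split; [apply/mem_set; right|move=> t /set_mem[->|->]].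
pose r (n : nat) : R := n.+1%:R^-1.
have r0 n : 0 < r n by rewrite invr_gt0 ltr0n.
(* the points assigned to z that are r k-deep in the ball B(z, r n) *)
pose C n k z := [set y | [/\ d z y < r n, forall w, d w y < r n -> W z w &
  forall t, d y t < r k -> d z t < r n]].
have Csep n k z w y t : C n k z y -> C n k w t -> d y t < r k -> z = w.
  move=> [zy zmin zin] [wt wmin win] yt.
  apply: Wanti; first by apply: zmin; apply: win; rewrite distC.
  by apply: wmin; apply: zin.
pose N m : set_system Z :=
  if unpickle m is Some (n, k) then range (C n k) else set0.
exists N; split.
  move=> m z; rewrite /N; case: (unpickle m) => [[n k]|]; last first.
    by exists setT; [exact: filterT|rewrite set0I].
  exists [set y | d z y < r k / 2].
    by apply: nbhs_ball_dist; have := r0 k; lra.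
  set B := [set y | d z y < _].
  have [[w [y [Cy By]]]|no] := pselect (exists w, C n k w `&` B !=set0).
    apply: (@sub_finite_set _ _ [set C n k w]); last exact: finite_set1.
    move=> _ [[w' _ <-]] [t [Ct Bt]] /=; congr C.
    apply: (Csep _ _ _ _ _ _ Ct Cy); move: Bt By; rewrite /B /= => Bt By.
    by have := dist_triangle z t y; rewrite (distC t z); lra.
  rewrite (_ : _ `&` _ = set0)//; apply/seteqP; split=> // _ [[w _ <-]] ?.
  by apply: no; exists w.
move=> y O /nbhs_dist[e e0 eO].
have [n0 /(_ n0 (leqnn _)) n0e] : exists N, forall n, (N <= n)%N -> r n < e / 2.
  by apply: invS_small; lra.
have [z [zy zmin]] : exists z, d z y < r n0 /\ forall w, d w y < r n0 -> W z w.
  by apply: (Wmin [set z | d z y < r n0]); exists y; rewrite /= distxx.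
have [k /(_ k (leqnn _)) kd] :
    exists N, forall n, (N <= n)%N -> r n < r n0 - d z y.
  by apply: invS_small; lra.
exists (C n0 k z); first by exists (pickle (n0, k)) => //; rewrite /N pickleK.
split.
  by split=> // t yt; have := dist_triangle y z t; lra.
move=> t [zt _ _]; apply: eO.
by have := dist_triangle z y t; rewrite (distC y z); lra.
Qed.

Lemma metrizable_cs_star : countable_cs_star_character Z.
Proof.
move=> z; exists (range (fun n : nat => [set y | d z y < n.+1%:R^-1])).
  exact: card_image_le.
move=> u O /cvg_dist uz /nbhs_dist[e e0 eO].
have [n /(_ n (leqnn _)) ne] := invS_small e0.
have r0 : 0 < n.+1%:R^-1 :> R by rewrite invr_gt0 ltr0n.
exists [set y | d z y < n.+1%:R^-1]; first by exists n.
split; first by rewrite /= distxx.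
- by move=> y /= zy; apply: eO; exact: lt_trans zy ne.
- have [N HN] := uz _ r0; apply: infinite_tail HN.
Qed.

End Metric.

Section Implications.
Variable Z : topologicalType.

Lemma frechet_urysohn_sequential : frechet_urysohn_space Z -> sequential_space Z.
Proof.
move=> FU A nA.
have [z [clz nAz]] : exists z, closure A z /\ ~ A z.
  apply: contrapT => h; apply: nA => z clz; apply: contrapT => nAz.
  by apply: h; exists z.
by have [u uA uz] := FU A z clz; exists u, z.
Qed.

Lemma sequential_k_space : sequential_space Z -> k_space Z.
Proof.
move=> Sq A nA; have [u [z [uA uz [_ nAz]]]] := Sq A nA.
exists (z |` range u).
  move=> F PF FK; apply: contrapT => nocl.
  have [B [U [FB zU BU]]] : exists B U, [/\ F B, nbhs z U & ~ (B `&` U !=set0)].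
    apply: contrapT => h; apply: nocl; exists z; split; first by left.
    by move=> B U FB zU; apply: contrapT => BU; apply: h; exists B, U.
  have [N _ HN] := uz _ zU.
  have FN : F (u @` `I_N).
    apply: filterS (filterI FB FK) => y [By [yz|[n _ ny]]].
      by case: BU; exists y; split=> //; rewrite yz; apply: nbhs_singleton.
    exists n => //=; rewrite ltnNge; apply/negP => Nn.
    by case: BU; exists y; split=> //; rewrite -ny; apply: HN.
  have [y [[n _ ny] Fy]] :=
    finite_compact (finite_image u (finite_II N)) PF FN.
  by apply: nocl; exists y; split=> //; right; exists n.
move=> [C cC AC]; apply: nAz.
suff : (C `&` (z |` range u)) z by rewrite -AC => -[].
split; last by left.
apply: (@closed_cvg _ _ _ _ u C cC _ z uz); apply: nearW => n.
suff : (C `&` (z |` range u)) (u n) by case.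
by rewrite -AC; split; [exact: uA|right; exists n].
Qed.

Lemma frechet_urysohn_tight : frechet_urysohn_space Z -> countable_tightness Z.
Proof.
move=> FU A z clz; have [u uA uz] := FU A z clz.
exists (range u); split.
- by move=> _ [n _ <-].
- exact: card_image_le.
- apply: (@closed_cvg _ _ _ _ u (closure (range u)) _ _ z uz); first exact: closed_closure.
  by apply: nearW => n; apply: subset_closure; exists n.
Qed.

End Implications.

(** * Truncated suprema of real sequences *)

Section TruncatedSup.
Variable R : realType.
Implicit Types u v w : nat -> R.

Definition trunc_sup u : R := sup (range (fun n => Num.min `|u n| n.+1%:R^-1)).

Lemma trunc_sup_ub u n : Num.min `|u n| n.+1%:R^-1 <= trunc_sup u.
Proof.
apply: ub_le_sup; last by exists n.
exists 1 => _ [k _ <-]; rewrite ge_min; apply/orP; right.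
by rewrite invf_le1 ?ltr0n// ler1n.
Qed.

Lemma trunc_sup_le u e :
  (forall n, Num.min `|u n| n.+1%:R^-1 <= e) -> trunc_sup u <= e.
Proof.
move=> ue; apply: ge_sup; first by exists (Num.min `|u 0%N| 0.+1%:R^-1), 0%N.
by move=> _ [n _ <-].
Qed.

Lemma trunc_sup_ge0 u : 0 <= trunc_sup u.
Proof.
apply: le_trans (trunc_sup_ub u 0); rewrite le_min normr_ge0/=.
by rewrite invr_ge0 ler0n.
Qed.

Lemma trunc_sup_eq0 u : trunc_sup u = 0 <-> forall n, u n = 0.
Proof.
split=> [u0 n|u0]; last first.
  apply/eqP; rewrite eq_le trunc_sup_ge0 andbT; apply: trunc_sup_le => n.
  by rewrite u0 normr0 ge_min lexx.
have := trunc_sup_ub u n; rewrite u0 ge_min normr_le0 => /orP[/eqP//|].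
by rewrite leNgt invr_gt0 ltr0n.
Qed.

Lemma trunc_sup_lt u n e : trunc_sup u < e -> e <= n.+1%:R^-1 -> `|u n| < e.
Proof.
move=> ue en; have := le_lt_trans (trunc_sup_ub u n) ue.
by rewrite gt_min => /orP[//|]; rewrite ltNge en.
Qed.

Lemma trunc_sup_triangle u v w : (forall n, `|u n| <= `|v n| + `|w n|) ->
  trunc_sup u <= trunc_sup v + trunc_sup w.
Proof.
move=> uvw; apply: trunc_sup_le => n.
have := trunc_sup_ub v n; have := trunc_sup_ub w n; have := uvw n.
have := normr_ge0 (v n); have := normr_ge0 (w n).
have : 0 < n.+1%:R^-1 :> R by rewrite invr_gt0 ltr0n.
move: (n.+1%:R^-1) => r.
by case: (leP `|u n| r); case: (leP `|v n| r); case: (leP `|w n| r); lra.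
Qed.

(** Only finitely many coordinates matter at a given precision; this is what
    makes [trunc_sup] continuous for pointwise convergence. *)
Lemma trunc_sup_small e : 0 < e ->
  exists N, forall u, (forall n, (n < N)%N -> `|u n| < e) -> trunc_sup u <= e.
Proof.
move=> e0; have [N HN] := invS_small e0; exists N => u uN.
apply: trunc_sup_le => n; rewrite ge_min.
have [Nn|nN] := leqP N n; apply/orP; [right|left].
  exact/ltW/HN.
exact/ltW/uN.
Qed.

End TruncatedSup.

(** * Zero-sets and Baire functions *)

Section ZeroSets.
Variables (R : realType) (X : topologicalType).
Local Notation zero := (@zero_sets R X).

Lemma zero_setT : zero setT.
Proof.
exists (fun=> 0); first exact: cst_continuous.
by rewrite predeqE => y; split.
Qed.

Lemma zero_set_bigcap (A : nat -> set X) :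
  (forall n, zero (A n)) -> zero (\bigcap_n A n).
Proof.
move=> zA.
have /choice[f Hf] n :
    exists f : X -> R, continuous f /\ A n = f @^-1` [set 0].
  by have [f cf ->] := zA n; exists f.
exists (fun x => trunc_sup (f ^~ x)); last first.
  apply/seteqP; split=> x /=.
    move=> Ax; apply/trunc_sup_eq0 => n.
    by have := Ax n I; rewrite (Hf n).2.
  by move/trunc_sup_eq0 => fx n _; rewrite (Hf n).2.
move=> x; apply/cvgrPdist_le => e e0.
have [N HN] := trunc_sup_small e0.
have near_x : \forall y \near x, forall n, (n < N)%N -> `|f n x - f n y| < e.
  have : \forall y \near x, forall i : 'I_N, `|f i x - f i y| < e.
    apply: filter_forall => i; have /cvgrPdist_lt := (Hf i).1 x; exact.
  by apply: filterS => y xy n nN; exact: (xy (Ordinal nN)).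
apply: filterS near_x => y xy.
have tri (a b : X) : trunc_sup (f ^~ a) <=
    trunc_sup (f ^~ b) + trunc_sup (fun n => f n a - f n b).
  apply: trunc_sup_triangle => n.
  by apply: le_trans (ler_normD _ _); rewrite addrC subrK.
have h1 := HN _ xy.
have h2 : trunc_sup (fun n => f n y - f n x) <= e.
  by apply: HN => n nN; rewrite distrC; exact: xy.
by have := tri x y; have := tri y x; rewrite ler_norml; lra.
Qed.

Lemma zero_set_bigcap_countable (I : Type) (D : set I) (A : I -> set X) :
  countable D -> (forall i, D i -> zero (A i)) ->
  zero [set x | forall i, D i -> A i x].
Proof.
move=> cD zA; have [D0|D0] := pselect (D !=set0); last first.
  rewrite (_ : [set x | _] = setT); first exact: zero_setT.
  by apply/seteqP; split=> // x _ i Di; case: D0; exists i.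
have [u Du uD] := countable_range_nat cD D0.
rewrite (_ : [set x | _] = \bigcap_n A (u n)).
  by apply: zero_set_bigcap => n; exact: zA.
apply/seteqP; split=> x /= Ax; first by move=> n _; exact: Ax.
by move=> i /uD[n <-]; exact: Ax.
Qed.

Lemma zero_setI (A B : set X) : zero A -> zero B -> zero (A `&` B).
Proof.
move=> zA zB; pose C b := if b then A else B.
rewrite (_ : A `&` B = [set x | forall b, setT b -> C b x]).
  by apply: zero_set_bigcap_countable => // -[].
apply/seteqP; split=> x /= => [[Ax Bx] [] //|Cx].
by split; [exact: (Cx true)|exact: (Cx false)].
Qed.

Lemma zero_setU (A B : set X) : zero A -> zero B -> zero (A `|` B).
Proof.
move=> [f cf ->] [g cg ->]; exists (fun x => f x * g x).
  by move=> x; apply: cvgM; [exact: cf|exact: cg].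
apply/seteqP; split=> x /=; first by case=> ->; rewrite ?mul0r ?mulr0.
by move/eqP; rewrite mulf_eq0 => /orP[]/eqP; [left|right].
Qed.

Lemma zero_set_bigcup (I : eqType) (s : seq I) (A : I -> set X) :
  (forall i, i \in s -> zero (A i)) -> zero [set x | exists2 i, i \in s & A i x].
Proof.
elim: s => [_|i s IH zA].
  exists (fun=> 1); first exact: cst_continuous.
  apply/seteqP; split=> x /=; first by case.
  by move/eqP; rewrite oner_eq0.
rewrite (_ : [set x | _] = A i `|` [set x | exists2 i, i \in s & A i x]).
  apply: zero_setU; first by apply: zA; exact: mem_head.
  by apply: IH => j js; apply: zA; rewrite in_cons js orbT.
apply/seteqP; split=> x /=.
  move=> [j]; rewrite in_cons => /orP[/eqP ->|js] Aj; first by left.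
  by right; exists j.
move=> [Ai|[j js Aj]]; first by exists i => //; exact: mem_head.
by exists j => //; rewrite in_cons js orbT.
Qed.

Lemma zero_set_separate (A : set X) x :
  zero A -> ~ A x -> exists2 B, zero B & B x /\ forall y, B y -> ~ A y.
Proof.
move=> [f cf ->] /= fx0.
exists [set y | `|f y| - `|f x| = 0].
  exists (fun y => `|f y| - `|f x|) => // y.
  by apply: cvgB; [apply: cvg_norm; exact: cf|exact: cvg_cst].
split; first by rewrite /= subrr.
move=> y /= fyx fy0; apply: fx0; apply/eqP; rewrite -normr_eq0.
by apply/eqP; move: fyx; rewrite fy0 normr0; lra.
Qed.

Lemma open_baire (U : set (baire_space R X)) :
  open U <-> forall x, U x -> exists2 A, zero A & A x /\ A `<=` U.
Proof.
split.
  move=> [D' sD <-] x [A DA Ax]; exists A; first by apply: sD.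
  by split=> // y Ay; exists A.
move=> HU; exists (zero `&` [set A | A `<=` U]); first by move=> A [].
apply/seteqP; split=> x; first by move=> [A [_ AU] Ax]; exact: AU.
by move=> /HU[A zA [Ax AU]]; exists A.
Qed.

Lemma zero_set_open (A : set X) : zero A -> open (A : set (baire_space R X)).
Proof. by move=> zA; apply/open_baire => x Ax; exists A => //; split. Qed.

Lemma open_baire_seq (U : set (baire_space R X)) (s : seq X) : open U ->
  (forall x, x \in s -> U x) ->
  exists2 A, zero A & (forall x, x \in s -> A x) /\ A `<=` U.
Proof.
move=> /open_baire oU sU.
have /choice[A HA] x : exists A, zero A /\ (U x -> A x /\ A `<=` U).
  have [Ux|nUx] := pselect (U x).
    by have [A zA HA] := oU x Ux; exists A.
  by exists setT; split; [exact: zero_setT|].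
exists [set x | exists2 i, i \in s & A i x].
  by apply: zero_set_bigcup => i _; case: (HA i).
split=> [x xs|y /= [x xs]]; last first.
  by have [_ /(_ (sU _ xs))[_ AU]] := HA x; exact: AU.
by exists x => //; have [_ /(_ (sU _ xs))[]] := HA x.
Qed.

(** Countable sets are closed for the Baire topology: intersect the zero-sets that
    exclude one point each. *)
Lemma zero_set_avoid (D : set X) x : tychonoff_space X -> countable D ->
  ~ D x -> exists2 A, zero A & A x /\ forall y, A y -> ~ D y.
Proof.
move=> [hX crX] cD nDx.
have /choice[A HA] y : exists A, zero A /\ (D y -> A x /\ ~ A y).
  have [Dy|nDy] := pselect (D y); last first.
    by exists setT; split; [exact: zero_setT|].
  have cy : closed [set y] by apply: accessible_closed_set1; exact: hausdorff_accessible.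
  have nyx : ~ [set y] x by move=> /= xy; apply: nDx; rewrite xy.
  have /(@uniform_separatorP _ R)[f [cf _ f0 f1]] := crX x _ cy nyx.
  exists (f @^-1` [set 0]); split; first by exists f.
  move=> _; split; first by apply: f0; exists x.
  have /= -> : f y = 1 by apply: f1; exists y.
  by move/eqP; rewrite oner_eq0.
exists [set z | forall y, D y -> A y z].
  by apply: zero_set_bigcap_countable => // y Dy; case: (HA y).
split=> [y Dy|z /= Az Dz]; first by have [_ /(_ Dy)[]] := HA y.
by have [_ /(_ Dz)[_]] := HA z; apply; exact: Az.
Qed.

Variables (E : topologicalType) (d : E -> E -> R).
Hypothesis dE : metrizes d.

(** For a continuous [h] the fibre is the zero-set of the distance to [h x], and a
    limit is constant wherever every term is. In particular [h] is continuous from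
    the Baire topology to the discrete topology on [E]. *)
Lemma baire_function_fibre (h : X -> E) x : baire_functions h ->
  exists2 A, zero A & A x /\ forall y, A y -> h y = h x.
Proof.
move=> [I [le [_ [a ah]]]]; elim: ah => {a h}.
  move=> a h _ ch; exists [set y | d (h y) (h x) = 0]; last first.
    by split=> [|y /=]; [rewrite /= (distxx dE)|exact: dist_eq0].
  exists (fun y => d (h y) (h x)) => // y.
  apply/cvgrPdist_lt => e e0.
  have hy : nbhs y (h @^-1` [set z | d (h y) z < e]).
    exact: ch (nbhs_ball_dist dE (h y) e0).
  apply: filterS hy => z /= yz.
  have := dist_triangle dE (h z) (h y) (h x).
  have := dist_triangle dE (h y) (h z) (h x).
  by rewrite (distC dE (h z) (h y)) ltr_norml; lra.
move=> a h b u _ _ IH uh.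
have /choice[A HA] n :
    exists A, zero A /\ (A x /\ forall y, A y -> u n y = u n x).
  by have [A zA HA] := IH n; exists A.
exists (\bigcap_n A n).
  by apply: zero_set_bigcap => n; case: (HA n).
split=> [n _|y Ay]; first by case: (HA n) => _ [].
apply: (cvg_dist_unique dE (uh y)).
rewrite (_ : (fun n => u n y) = (fun n => u n x)); first exact: uh.
by apply: funext => n; case: (HA n) => _ [_]; apply; exact: Ay.
Qed.

Lemma baire_functions_fibre (C : set (X -> E)) x :
  countable C -> C `<=` @baire_functions X E ->
  exists2 A, zero A & A x /\ forall y, A y -> forall h, C h -> h y = h x.
Proof.
move=> cC CB.
have /choice[A HA] h : exists A, C h ->
    [/\ zero A, A x & forall y, A y -> h y = h x].
  have [Ch|nCh] := pselect (C h); last by exists setT.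
  by have [A zA [Ax Ah]] := baire_function_fibre x (CB h Ch); exists A.
exists [set y | forall h, C h -> A h y].
  by apply: zero_set_bigcap_countable => // h /HA[].
split=> [h /HA[]//|y Ay h Ch].
by have [_ _] := HA h Ch; apply; exact: Ay.
Qed.

End ZeroSets.

(** * Spaces of Baire functions *)

Section PointwiseTopology.
Variables (R : realType) (X E : topologicalType) (d : E -> E -> R).
Hypothesis dE : metrizes d.
Variable H : set {ptws X -> E}.

Definition value (h : set_type H) (x : X) : E := (set_val h : X -> E) x.

Lemma value_inj (g h : set_type H) : (forall x, value g x = value h x) -> g = h.
Proof. by move=> gh; apply: val_inj; apply: funext. Qed.

Lemma value_continuous x : continuous (value ^~ x).
Proof.
move=> h A hA.
have : nbhs (set_val h) (@proj _ (fun=> E) x @^-1` A).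
  exact: (@proj_continuous X (fun=> E) x (set_val h) A hA).
exact: (@initial_continuous (set_type H) {ptws X -> E} set_val h).
Qed.

Lemma nbhs_value (p : set_type H) (s : seq X) (e : R) : 0 < e ->
  nbhs p [set h | forall x, x \in s -> d (value p x) (value h x) < e].
Proof.
move=> e0; elim: s => [|x s IH].
  by apply: filterS filterT => h _ x; rewrite in_nil.
have px : nbhs p ((value ^~ x) @^-1` [set y | d (value p x) y < e]).
  exact: value_continuous (nbhs_ball_dist dE (value p x) e0).
apply: filterS (filterI px IH) => h [hx hs] y.
by rewrite in_cons => /orP[/eqP ->//|]; exact: hs.
Qed.

(** The right-hand sets form a filter converging to [p] along each coordinate. *)
Lemma nbhs_valueP (p : set_type H) (B : set (set_type H)) : nbhs p B <->
  exists (s : seq X) (e : R), 0 < e /\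
    forall h, (forall x, x \in s -> d (value p x) (value h x) < e) -> B h.
Proof.
split; last first.
  by move=> [s [e [e0 eB]]]; apply: filterS (nbhs_value p s e0) => h; exact: eB.
pose basic (i : seq X * R) : set {ptws X -> E} :=
  [set f | forall x, x \in i.1 -> d (value p x) (f x) < i.2].
pose G := filter_from [set i : seq X * R | 0 < i.2] basic.
have FG : Filter G.
  apply: filter_from_filter; first by exists ([::], 1) => /=.
  move=> [s e] [t c] /= e0 c0; exists (s ++ t, Num.min e c).
    by rewrite /= lt_min e0 c0.
  move=> f Hf; split=> x /= xs.
    have := Hf x; rewrite /= mem_cat xs => /(_ isT); rewrite lt_min.
    by case/andP.
  have := Hf x; rewrite /= mem_cat xs orbT => /(_ isT); rewrite lt_min.
  by case/andP.
have Gp : G --> (set_val p : {ptws X -> E}).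
  apply/cvg_sup => x A [_ [[W oW <-] Wp WA]].
  have /(nbhs_dist dE)[e e0 eW] : nbhs (value p x) W by exact: open_nbhs_nbhs.
  exists ([:: x], e) => // f fe; apply: WA; apply: eW.
  by apply: fe; rewrite mem_seq1.
move=> [_ [[W oW <-] Wp WB]].
have /Gp[[s e] e0 eW] : nbhs (set_val p) W by exact: open_nbhs_nbhs.
exists s, e; split=> // h hs; apply: WB; exact: eW.
Qed.

Lemma closure_valueP (A : set (set_type H)) p : closure A p <->
  forall (s : seq X) (e : R), 0 < e ->
    exists2 h, A h & forall x, x \in s -> d (value p x) (value h x) < e.
Proof.
split=> [clA s e e0|HA B /nbhs_valueP[s [e [e0 eB]]]].
  by have [h [Ah hs]] := clA _ (nbhs_value p s e0); exists h.
by have [h Ah hs] := HA s e e0; exists h; split=> //; exact: eB.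
Qed.

Lemma cvg_valueP (u : nat -> set_type H) p : u @ \oo --> p <->
  forall x, (fun n => value (u n) x) @ \oo --> value p x.
Proof.
split=> [up x|up B /nbhs_valueP[s [e [e0 eB]]]].
  by move=> A pA; exact: up (value_continuous pA).
have : \forall n \near \oo, forall x, x \in s -> d (value p x) (value (u n) x) < e.
  elim: s {eB} => [|x s IH].
    by apply: filterS filterT => h _ x; rewrite in_nil.
  have ux : \forall n \near \oo, d (value p x) (value (u n) x) < e.
    exact: up (nbhs_ball_dist dE (value p x) e0).
  apply: filterS (filterI ux IH) => h [hx hs] y.
  by rewrite in_cons => /orP[/eqP ->//|]; exact: hs.
by apply: filterS => n; exact: eB.
Qed.

(** Enumerate [X] and take the truncated supremum of the coordinate distances. *)
Lemma metrizable_pointwise : countable [set: X] -> metrizable (set_type H) R.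
Proof.
move=> cX; have [X0|X0] := pselect ([set: X] !=set0); last first.
  exists (fun _ _ => 0); split.
  - move=> g h; split=> // _; apply: value_inj => x.
    by case: X0; exists x.
  - by [].
  - by move=> f g h; rewrite addr0.
  - move=> h; apply/seteqP; split=> B.
      move=> hB; exists 1 => //= g _.
      rewrite (_ : g = h); first exact: nbhs_singleton.
      by apply: value_inj => x; case: X0; exists x.
    move=> [e /= e0 eB]; rewrite (_ : B = setT); first exact: filterT.
    by apply/seteqP; split=> // g _; exact: eB.
have [q _ qX] := countable_range_nat cX X0.
pose D (g h : set_type H) n := d (value g (q n)) (value h (q n)).
have Dn g h n : `|D g h n| = D g h n by rewrite ger0_norm// (dist_ge0 dE).
exists (fun g h => trunc_sup (D g h)); split.
- move=> g h; rewrite trunc_sup_eq0; split=> [gh|-> n]; last exact: distxx.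
  by apply: value_inj => x; have [n <-] := qX x I; exact: (dist_eq0 dE (gh n)).
- by move=> g h; congr trunc_sup; apply: funext => n; exact: distC.
- move=> f g h; apply: trunc_sup_triangle => n.
  by rewrite !Dn; exact: dist_triangle.
- move=> g; apply/seteqP; split=> B.
    move=> /nbhs_valueP[s [e [e0 eB]]].
    have [c [c0 ce Hc]] : exists c, [/\ 0 < c, c <= e & forall x, x \in s ->
        exists2 n, q n = x & c <= n.+1%:R^-1].
      elim: s {eB} => [|x s [c [c0 ce Hc]]]; first by exists e.
      have [n qn] := qX x I.
      have n0 : 0 < n.+1%:R^-1 :> R by rewrite invr_gt0 ltr0n.
      exists (Num.min c n.+1%:R^-1); split.
      + by rewrite lt_min c0.
      + by rewrite ge_min ce.
      + move=> y; rewrite in_cons => /orP[/eqP ->|/Hc[m qm cm]].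
          by exists n => //; rewrite ge_min lexx orbT.
        by exists m => //; rewrite ge_min cm.
    exists c => //= h gh; apply: eB => x /Hc[n <- cn].
    by have := trunc_sup_lt gh cn; rewrite Dn => /lt_le_trans; apply.
  move=> [e /= e0 eB]; apply/nbhs_valueP.
  have e20 : 0 < e / 2 by rewrite divr_gt0.
  have [N HN] := trunc_sup_small e20.
  exists [seq q n | n <- iota 0 N], (e / 2); split=> // h gh; apply: eB.
  apply: (@le_lt_trans _ _ (e / 2)); last by lra.
  apply: HN => n nN; rewrite Dn; apply: gh; apply: map_f.
  by rewrite mem_iota.
Qed.

End PointwiseTopology.

Section TwoValued.
Variables (R : realType) (X E : topologicalType) (d : E -> E -> R).
Hypothesis dE : metrizes d.
Variable psi : R -> E.
Hypothesis psi_continuous : continuous psi.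

(** With [A] the zero-set of [f], the continuous real functions
    a + (b - a) min(1, k |f|) are a on [A] and, at a point off [A], are b as soon
    as k |f| reaches 1. *)
Lemma two_valued_stable (A : set X) (a b : R) : @zero_sets R X A ->
  stable_baire1_rc (fun x => psi (if `[< A x >] then a else b)).
Proof.
move=> [f cf ->]; split.
  pose g (k : nat) (x : X) : R := a + (b - a) * Num.min 1 (k%:R * `|f x|).
  have cg k : continuous (g k).
    move=> x; apply: cvgD; first exact: cvg_cst.
    apply: cvgM; first exact: cvg_cst.
    apply: (@continuous_min _ _ (fun=> 1) (fun x => k%:R * `|f x|) x).
      exact: cvg_cst.
    by apply: cvgM; [exact: cvg_cst|apply: cvg_norm; exact: cf].
  exists (fun k => psi \o g k).
    by move=> k x; apply: continuous_comp; [exact: cg|exact: psi_continuous].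
  move=> x; rewrite /= /g; case: asboolP => /= fx.
    rewrite (_ : [set n | _] = set0)//; apply/seteqP; split=> // k /=; apply.
    by rewrite fx normr0 mulr0 minEle ler10 mulr0 addr0.
  have fx0 : 0 < `|f x| by rewrite normr_gt0; apply/eqP.
  have [N HN] := invS_small fx0.
  apply: (@sub_finite_set _ _ `I_N.+1); last exact: finite_II.
  move=> k /= kb; rewrite ltnNge; apply/negP => Nk; apply: kb.
  rewrite minEle ifT; first by rewrite mulr1 addrC subrK.
  have k0 : 0 < k%:R :> R by rewrite ltr0n; apply: leq_trans Nk.
  have := HN k.-1; rewrite prednK; last by apply: leq_trans Nk.
  move=> /(_ _)/ltW; rewrite -ler_pdivrMl// mulr1; apply.
  by rewrite -ltnS prednK//; apply: leq_trans Nk.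
exists [set psi a; psi b].
  by move=> _ [x _ <-]; case: asboolP; [left|right].
have fin : finite_set [set psi a; psi b] by exact: finite_set2.
split; first exact: finite_compact.
apply: compact_closed; first exact: metrizes_hausdorff dE.
exact: finite_compact.
Qed.

End TwoValued.

Definition contains_two_valued (R : realType) (X E : topologicalType)
    (psi : R -> E) (H : set {ptws X -> E}) :=
  forall (A : set X) (a b : R), @zero_sets R X A ->
    H (fun x => psi (if `[< A x >] then a else b)).

Section FunctionSpace.
Variables (R : realType) (X E : topologicalType) (d : E -> E -> R).
Hypothesis dE : metrizes d.
Variable psi : R -> E.
Hypothesis psi_inj : injective psi.
Hypothesis X_tychonoff : tychonoff_space X.
Variable H : set {ptws X -> E}.
Hypothesis H_two_valued : contains_two_valued psi H.

Local Notation zero := (@zero_sets R X).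
Local Notation hT := (set_type H).

Lemma two_valued (A : set X) (a b : R) : zero A -> exists h : hT,
  forall x, (A x -> value h x = psi a) /\ (~ A x -> value h x = psi b).
Proof.
move=> zA; exists (SigSub (mem_set (H_two_valued a b zA))) => x.
by split=> Ax; rewrite -[LHS]/(psi (if `[< A x >] then a else b)); case: asboolP.
Qed.

Lemma constant_value a : exists h : hT, forall x, value h x = psi a.
Proof.
have [h hE] := two_valued a a (@zero_setT R X).
by exists h => x; exact: (hE x).1.
Qed.

Lemma psi_dist_gt0 a b : a <> b -> 0 < d (psi a) (psi b).
Proof. by move=> ab; apply: (dist_gt0 dE) => /psi_inj. Qed.

(** Local finiteness yields countably many neighbourhoods of the constant psi 0
    whose intersection is a point. They depend on a countable set of coordinates;
    a two-valued function supported by a zero-set that avoids this set shows that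
    it is all of [X]. *)
Lemma sigma_space_countable : sigma_space hT -> countable [set: X].
Proof.
move=> [N [lfN netN]].
have [p0 p0E] := constant_value 0.
(* a neighbourhood of p0 missing the members of N n that are far from p0 *)
have /choice[U HU] n : exists U : set hT, nbhs p0 U /\
    forall M, N n M -> ~ closure M p0 -> forall h, M h -> ~ U h.
  have [V V0 finV] := lfN n p0.
  have /choice[W HW] M : exists W : set hT,
      nbhs p0 W /\ (~ closure M p0 -> forall h, M h -> ~ W h).
    have [clM|/existsNP[W /not_implyP[W0 MW]]] := pselect (closure M p0).
      by exists setT; split=> //; exact: filterT.
    by exists W; split=> // _ h Mh Wh; apply: MW; exists h.
  have [s sE] := (finite_seqP _).1 finV.
  exists (V `&` [set h | forall M, M \in s -> W M h]); split.
    apply: filterI => //.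
    elim: s {sE} => [|M s IH]; first by apply: filterS filterT => h _ M.
    apply: filterS (filterI (HW M).1 IH) => h [hM hs] M'.
    by rewrite in_cons => /orP[/eqP ->|/hs].
  move=> M NM clM h Mh [Vh Wh]; apply: (HW M).2 (Mh) _ => //.
  by apply: Wh; have : [set` s] M by rewrite -sE; split=> //; exists h.
have /choice[s Hs] n : exists s : seq X, forall h : hT,
    (forall x, x \in s -> value h x = psi 0) -> U n h.
  have /(nbhs_valueP dE)[s [e [e0 eU]]] := (HU n).1.
  by exists s => h hs; apply: eU => x xs; rewrite p0E hs// (distxx dE).
pose D := \bigcup_n [set` s n].
have cD : countable D by apply: bigcup_countable => // n _; exact: finite_set_countable (finite_seq (s n)).
suff DT : D = setT by rewrite -DT.
apply/seteqP; split=> // x _; apply: contrapT => nDx.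
have [A zA [Ax AD]] := zero_set_avoid R X_tychonoff cD nDx.
have [h hE] := two_valued 1 0 zA.
have hx : value h x = psi 1 by apply: (hE x).1.
have e0 : 0 < d (psi 0) (psi 1) / 2.
  by rewrite divr_gt0// psi_dist_gt0// => /eqP; rewrite eq_sym oner_eq0.
have /netN[M [n _ NM] [Mh MO]] := nbhs_value dE h [:: x] e0.
apply: ((HU n).2 M NM _ h Mh); last first.
  apply: Hs => y ys; apply: (hE y).2 => /AD; apply.
  by exists n.
move=> /(_ _ (nbhs_value dE p0 [:: x] e0))[g [/MO gh gp]].
have := gh x (mem_head _ _); have := gp x (mem_head _ _).
rewrite p0E hx => g0 g1.
have := dist_triangle dE (value g x) (psi 0) (psi 1).
by rewrite (distC dE (value g x)); lra.
Qed.

(** Separate each term from all the other terms by a zero-set, then shrink this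
    zero-set to avoid the ones chosen earlier. *)
Lemma disjoint_zero_sets (q : nat -> X) : injective q ->
  exists G : nat -> set X, [/\ forall i, zero (G i), forall i, G i (q i) &
    forall i j x, G i x -> G j x -> i = j].
Proof.
move=> qinj.
have /choice[A HA] i : exists A, [/\ zero A, A (q i) &
    forall j, j <> i -> ~ A (q j)].
  have cD : countable (q @` [set j | j <> i]).
    by apply: sub_countable (card_image_le _ _) _; exact: countableP.
  have nD : ~ (q @` [set j | j <> i]) (q i) by move=> [j /= ji /qinj].
  have [A zA [Ai AD]] := zero_set_avoid R X_tychonoff cD nD.
  by exists A; split=> // j ji /AD; apply; exists j.
have /choice[B HB] ij : exists B, [/\ zero B, B (q ij.1) &
    (ij.2 < ij.1)%N -> forall x, B x -> ~ A ij.2 x].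
  case: ij => i j /=; have [ji|ij] := ltnP j i; last first.
    by exists setT; split=> //; exact: zero_setT.
  have [zA _ Aj] := HA j.
  have [|B zB [Bi BA]] := zero_set_separate zA (x := q i).
    by apply: Aj => ij; rewrite ij ltnn in ji.
  by exists B.
pose G i := A i `&` \bigcap_j B (i, j).
exists G; split.
- move=> i; apply: zero_setI; first by case: (HA i).
  by apply: zero_set_bigcap => j; case: (HB (i, j)).
- by move=> i; split=> [|j _]; [case: (HA i)|case: (HB (i, j))].
- suff lt_disj i j x : (j < i)%N -> G i x -> ~ G j x.
    move=> i j x Gi Gj; have [ij|ji|//] := ltngtP i j.
      by case: (lt_disj j i x ij Gj).
    by case: (lt_disj i j x ji Gi).
  move=> ji [_ Bi] [Aj _]; have [_ _ /(_ ji)] := HB (i, j).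
  by move=> /(_ x (Bi j I)).
Qed.

Lemma injective_choice (Y : nat -> set X) : (forall n, infinite_set (Y n)) ->
  exists2 q : nat -> X, injective q & forall n, Y n (q n).
Proof.
move=> infY.
have /choice[next Hnext] (ns : nat * seq X) : exists x, Y ns.1 x /\ x \notin ns.2.
  have [x [Yx xs]] : (Y ns.1 `\` [set` ns.2]) !=set0.
    by apply: infinite_setN0; apply: infinite_setD => //; exact: finite_seq.
  by exists x; split=> //; apply/negP.
pose F := fix F n := if n is m.+1 then next (m, F m) :: F m else [::].
exists (fun n => next (n, F n)); last by move=> n; case: (Hnext (n, F n)).
have FS m n : (m < n)%N -> next (m, F m) \in F n.
  elim: n => // n IH; rewrite ltnS leq_eqVlt => /orP[/eqP ->|/IH mn] /=.
    exact: mem_head.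
  by rewrite in_cons mn orbT.
move=> m n mn; have [ltmn|ltnm|//] := ltngtP m n.
  by have [_] := Hnext (n, F n); rewrite /= -mn FS.
by have [_] := Hnext (m, F m); rewrite /= mn FS.
Qed.

(** For a member M of a countable cs*-network at the constant psi 0, consider the
    set of coordinates at which M stays close to psi 0. Take two-valued functions
    with pairwise disjoint supports, the n-th support meeting the first n+1 of
    the infinite sets among these. They converge to psi 0, but a member M with an
    infinite set contains only finitely many of them. Hence the cs*-property at
    a coordinate x is witnessed by some M whose set is finite and contains x. *)
Lemma cs_star_countable : countable_cs_star_character hT -> countable [set: X].
Proof.
have [p0 p0E] := constant_value 0.
move=> /(_ p0)[N cN csN].
have [finX|infX] := pselect (finite_set [set: X]).
  exact: finite_set_countable.
pose Y (M : set hT) := [set x | forall h, M h ->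
  d (psi 0) (value h x) < d (psi 0) (psi 1)].
have psi01 : 0 < d (psi 0) (psi 1).
  by apply: psi_dist_gt0 => /eqP; rewrite eq_sym oner_eq0.
suff sub : [set: X] `<=` \bigcup_(M in N `&` [set M | finite_set (Y M)]) Y M.
  apply: sub_countable (subset_card_le sub) _; apply: bigcup_countable.
    by apply: sub_countable cN; apply: subset_card_le => M [].
  by move=> M [_ /finite_set_countable].
have nbhs_x x := nbhs_value dE p0 [:: x] psi01.
have N0 : N !=set0.
  have [M NM _] := csN (fun=> p0) setT (@cvg_cst _ _ _ _ _) filterT.
  by exists M.
have [M_ NM_ HM_] := countable_range_nat cN N0.
have [q qinj qY] := @injective_choice
  (* the k-th set is used for every index pickle (n, k); finite sets are replaced by
     the whole of X to keep the family total *)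
  (fun i => let k := (odflt (0, 0)%N (unpickle i)).2 in
     if pselect (infinite_set (Y (M_ k))) then Y (M_ k) else setT)
  (fun i => ltac:(by move=> /=; case: pselect)).
have [G [zG Gq Gdisj]] := disjoint_zero_sets qinj.
pose Z n := [set x | exists2 k, k \in iota 0 n.+1 & G (pickle (n, k)) x].
have /choice[h hE] n := two_valued 1 0 (zero_set_bigcup
  (fun k (_ : k \in iota 0 n.+1) => zG (pickle (n, k)))).
have h0 : h @ \oo --> p0.
  apply/(cvg_valueP dE) => x; rewrite p0E; apply/(cvg_dist dE) => e e0.
  suff [N1 HN1] : exists N1, forall n, (N1 <= n)%N -> ~ Z n x.
    exists N1 => n /HN1 nZ; rewrite (_ : value (h n) x = psi 0) ?(distxx dE)//.
    exact: (hE n x).2.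
  have [[n [k _ Gx]]|no] := pselect (exists n, Z n x); last first.
    by exists 0%N => n _ Zn; apply: no; exists n.
  exists n.+1 => m nm [l _ Gx'].
  have /(pcan_inj pickleK)[mn _] := Gdisj _ _ _ Gx Gx'.
  by rewrite mn ltnn in nm.
move=> x _; have [M NM [M0 MO infM]] := csN h _ h0 (nbhs_x x).
have Yx : Y M x by move=> g /MO/(_ x (mem_head _ _)); rewrite p0E.
exists M => //; split=> //; apply: contrapT => infY.
have [k kM] := HM_ M NM.
have [n [kn Mn]] : exists n, (k <= n)%N /\ M (h n).
  apply: contrapT => no; apply: infM; apply: (@sub_finite_set _ _ `I_k).
    by move=> n /= Mn; rewrite ltnNge; apply/negP => kn; apply: no; exists n.
  exact: finite_II.
have Yq : Y M (q (pickle (n, k))).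
  by have := qY (pickle (n, k)); rewrite pickleK /= kM; case: pselect.
have := Yq _ Mn.
rewrite (_ : value (h n) _ = psi 1) ?ltxx//; apply: (hE n _).1.
by exists k; [rewrite mem_iota/= ltnS|exact: Gq].
Qed.

End FunctionSpace.

(** * Countable omega-subcovers in the Baire topology *)

Section OmegaCovers.
Variables (R : realType) (X E : topologicalType) (d : E -> E -> R).
Hypothesis dE : metrizes d.
Variable psi : R -> E.
Hypothesis psi_inj : injective psi.
Variable H : set {ptws X -> E}.
Hypothesis H_baire : H `<=` @baire_functions X E.
Hypothesis H_two_valued : contains_two_valued psi H.

Local Notation zero := (@zero_sets R X).
Local Notation Y := (baire_space R X).
Local Notation hT := (set_type H).

Lemma omega_cover_seqP (N : set_system Y) :
  omega_cover N <-> forall s : seq X, exists2 U, N U & forall x, x \in s -> U x.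
Proof.
split=> [oN s|oN F finF].
  by have [U NU sU] := oN [set` s] (finite_seq s); exists U.
have [s ->] := (finite_seqP _).1 finF; have [U NU sU] := oN s.
by exists U.
Qed.

Definition countable_omega_subcovers := forall N : set_system Y,
  N `<=` open -> omega_cover N ->
  exists M, [/\ M `<=` N, countable M & omega_cover M].

Lemma gamma_omega_subcovers : gamma_property Y -> countable_omega_subcovers.
Proof.
move=> gY N oN covN; have [U NU Ucov] := gY N oN covN.
exists (range U); split.
- by move=> _ [n _ <-].
- by apply: sub_countable (card_image_le _ _) _; exact: countableP.
apply/omega_cover_seqP => s.
suff [n Hn] : exists n, forall i, (n <= i)%N -> forall x, x \in s -> U i x.
  by exists (U n); [exists n|exact: Hn].
elim: s => [|x s [n Hn]]; first by exists 0%N.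
have [m _ Hm] : (\bigcup_n \bigcap_(i in [set i | (n <= i)%N]) U i) x.
  by rewrite Ucov.
exists (maxn m n) => i; rewrite geq_max => /andP[mi ni] y.
by rewrite in_cons => /orP[/eqP ->|/(Hn i ni)//]; exact: Hm.
Qed.

(** The joint fibres of a countable family of Baire functions are open, so their
    finite unions form an open omega-cover, and a countable omega-subcover involves
    only countably many fibres. *)
Lemma omega_subcovers_representatives (C : set (X -> E)) :
  countable_omega_subcovers -> countable C -> C `<=` @baire_functions X E ->
  exists2 D : set X, countable D &
    forall y, exists2 x, D x & forall h, C h -> h y = h x.
Proof.
move=> Lin cC CB.
pose fibres (V : set Y) (s : seq X) :=
  forall y, V y -> exists2 x, x \in s & forall h, C h -> h y = h x.
have [||M [MN cM covM]] := Lin (open `&` [set V | exists s, fibres V s]).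
- by move=> V [].
- apply/omega_cover_seqP => s.
  exists [set y | exists2 x, x \in s & forall h, C h -> h y = h x].
    split; last by exists s.
    apply/open_baire => y /= [x xs yx].
    have [A zA [Ay AC]] := @baire_functions_fibre R X E d dE C y cC CB.
    exists A => //; split=> // z Az; exists x => // h Ch.
    by rewrite (AC z Az h Ch) yx.
  by move=> x xs; exists x.
have /choice[s Hs] V : exists s, M V -> fibres V s.
  have [MV|nMV] := pselect (M V); last by exists [::].
  by have [_ [s Hs]] := MN V MV; exists s.
exists (\bigcup_(V in M) [set` s V]).
  by apply: bigcup_countable => // V _; exact: finite_set_countable (finite_seq _).
move=> y; have [V MV /(_ y (mem_head _ _)) Vy] := (omega_cover_seqP M).1 covM [:: y].
by have [x xs yx] := Hs V MV y Vy; exists x => //; exists V.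
Qed.

(** First pass to a countable omega-cover by zero-sets. Their indicators factor
    through a countable set of representatives, so it is enough that the n-th
    member chosen contains the first n representatives. *)
Lemma omega_subcovers_gamma : countable_omega_subcovers -> gamma_property Y.
Proof.
move=> Lin N oN covN.
have [||M [MN cM covM]] := Lin (zero `&` [set A | exists2 U, N U & A `<=` U]).
- by move=> A [zA _]; exact: zero_set_open.
- apply/omega_cover_seqP => s; have [U NU sU] := (omega_cover_seqP N).1 covN s.
  have [A zA [sA AU]] := open_baire_seq (oN U NU) sU.
  by exists A => //; split=> //; exists U.
pose ind (A : set X) x := psi (if `[< A x >] then 1 else 0).
have [D cD Drep] : exists2 D : set X, countable D &
    forall y, exists2 x, D x & forall A, M A -> A y <-> A x.
  have [||D cD Drep] := @omega_subcovers_representatives (ind @` M) Lin.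
  - by apply: sub_countable (card_image_le _ _) _.
  - move=> _ [A MA <-]; apply: H_baire; apply: H_two_valued.
    by case: (MN A MA).
  exists D => // y; have [x Dx yx] := Drep y; exists x => // A MA.
  have /psi_inj := yx _ (ex_intro2 _ _ A MA erefl).
  case: asboolP => Ay; case: asboolP => Ax //.
    by move/eqP; rewrite oner_eq0.
  by move/eqP; rewrite eq_sym oner_eq0.
have [X0|X0] := pselect ([set: X] !=set0); last first.
  have [U NU _] := (omega_cover_seqP N).1 covN [::].
  by exists (fun=> U) => //; apply/seteqP; split=> // x _; case: X0; exists x.
have D0 : D !=set0.
  by have [y _] := X0; have [x Dx _] := Drep y; exists x.
have [q _ qD] := countable_range_nat cD D0.
have /choice[U HU] n : exists U, N U /\ exists2 A, M A & A `<=` U /\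
    forall i, (i <= n)%N -> A (q i).
  have [A MA qA] := (omega_cover_seqP M).1 covM [seq q i | i <- iota 0 n.+1].
  have [_ [U NU AU]] := MN A MA; exists U; split=> //; exists A => //; split=> //.
  by move=> i iN; apply: qA; apply: map_f; rewrite mem_iota /= ltnS.
exists U => [n|]; first by case: (HU n).
apply/seteqP; split=> // y _; have [x /qD[i <-] yx] := Drep y.
exists i => // n /= iN; have [_ [A MA [AU qA]]] := HU n.
by apply: AU; apply/(yx A MA); exact: qA.
Qed.

(** The functions psi 0 on a zero-set inside a member of the cover and psi 1
    elsewhere accumulate at the constant psi 0 precisely because the cover is an
    omega-cover. *)
Lemma tight_omega_subcovers : countable_tightness hT -> countable_omega_subcovers.
Proof.
move=> tH N oN covN.
have [p0 p0E] := constant_value H_two_valued 0.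
have psi01 : 0 < d (psi 0) (psi 1).
  by apply: (psi_dist_gt0 dE psi_inj) => /eqP; rewrite eq_sym oner_eq0.
pose A := [set h : hT | exists2 U, N U & forall x, value h x <> psi 1 -> U x].
have clA : closure A p0.
  apply/(closure_valueP dE) => s e e0.
  have [U NU sU] := (omega_cover_seqP N).1 covN s.
  have [Z zZ [sZ ZU]] := open_baire_seq (oN U NU) sU.
  have [h hE] := two_valued H_two_valued 0 1 zZ.
  exists h.
    exists U => // x hx; apply: ZU; apply: contrapT => nZ; apply: hx.
    exact: (hE x).2.
  by move=> x /sZ Zx; rewrite p0E (hE x).1// (distxx dE).
have [B [BA cB clB]] := tH A p0 clA.
have /choice[U HU] h : exists U, B h ->
    N U /\ forall x, value h x <> psi 1 -> U x.
  have [/BA[U NU hU]|nB] := pselect (B h); first by exists U.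
  by exists setT.
exists (U @` B); split.
- by move=> _ [h Bh <-]; case: (HU h Bh).
- by apply: sub_countable (card_image_le _ _) _.
apply/omega_cover_seqP => s.
have [h Bh hs] := (closure_valueP dE B p0).1 clB s _ psi01.
exists (U h); first by exists h.
move=> x /hs; rewrite p0E => hx; apply: (HU h Bh).2 => hx1.
by move: hx; rewrite hx1 ltxx.
Qed.

(** The sets where members of [A] are within 1/(n+1) of [p] form omega-covers, so
    [p] is in the closure of a countable part [B] of [A]. A sequence in [B] that
    converges to [p] at countably many representatives of the joint fibres
    converges everywhere. *)
Lemma omega_subcovers_frechet_urysohn :
  countable_omega_subcovers -> frechet_urysohn_space hT.
Proof.
move=> Lin A p clA.
have vB (h : hT) : baire_functions (value h) by exact: H_baire (set_valP h).
pose U n (h : hT) : set Y := [set x | d (value p x) (value h x) < n.+1%:R^-1].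
(* countably many elements of A suffice to have p in the closure *)
have [B [BA cB clB]] : exists B, [/\ B `<=` A, countable B & closure B p].
  have /choice[B HB] n : exists B : set hT, [/\ B `<=` A, countable B &
      forall s : seq X, exists2 h, B h & forall x, x \in s -> U n h x].
    have [||M [MN cM covM]] := Lin (U n @` A).
    - move=> _ [h Ah <-]; apply/open_baire => x Ux.
      have [V zV [Vx VC]] := @baire_functions_fibre R X E d dE _ x
        (finite_set_countable (finite_set2 (value p) (value h)))
        (fun f fC => ltac:(by case: fC => ->; exact: vB)).
      exists V => //; split=> // y /VC yx; rewrite /U /=.
      by rewrite (yx (value p))//; [rewrite (yx (value h))//; right|left].
    - apply/omega_cover_seqP => s.
      have e0 : 0 < n.+1%:R^-1 :> R by rewrite invr_gt0 ltr0n.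
      have [h Ah hs] := (closure_valueP dE A p).1 clA s _ e0.
      by exists (U n h) => //; exists h.
    have /choice[g Hg] V : exists h, M V -> A h /\ U n h = V.
      have [/MN[h Ah hV]|nM] := pselect (M V); first by exists h.
      by exists p.
    exists (g @` M); split.
    - by move=> _ [V MV <-]; case: (Hg V MV).
    - by apply: sub_countable (card_image_le _ _) _.
    - move=> s; have [V MV sV] := (omega_cover_seqP M).1 covM s.
      by exists (g V); [exists V|rewrite (Hg V MV).2].
  exists (\bigcup_n B n); split.
  - by move=> h [n _ Bh]; have [+ _ _] := HB n; apply.
  - by apply: bigcup_countable => // n _; case: (HB n).
  - apply/(closure_valueP dE) => s e e0.
    have [n /(_ n (leqnn _)) ne] := invS_small e0.
    have [_ _ /(_ s)[h Bh hs]] := HB n.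
    exists h; first by exists n.
    by move=> x /hs; rewrite /U /= => /lt_trans; apply.
have [||D cD Drep] := @omega_subcovers_representatives
  (@value X E H @` (p |` B)) Lin.
- apply: sub_countable (card_image_le _ _) _.
  rewrite -bigcup2E; apply: bigcup_countable => // -[|[|n]] _ //=; exact: countable1.
- by move=> _ [h _ <-].
have [X0|X0] := pselect ([set: X] !=set0); last first.
  have [h Ah _] := (closure_valueP dE A p).1 clA [::] 1 ltr01.
  exists (fun=> h) => //; apply/(cvg_valueP dE) => x; case: X0; exists x => //.
have D0 : D !=set0.
  by have [y _] := X0; have [x Dx _] := Drep y; exists x.
have [q _ qD] := countable_range_nat cD D0.
have /choice[u Hu] n : exists h, B h /\ forall i, (i <= n)%N ->
    d (value p (q i)) (value h (q i)) < n.+1%:R^-1.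
  have e0 : 0 < n.+1%:R^-1 :> R by rewrite invr_gt0 ltr0n.
  have [h Bh hs] := (closure_valueP dE B p).1 clB [seq q i | i <- iota 0 n.+1] _ e0.
  exists h; split=> // i iN; apply: hs; apply: map_f.
  by rewrite mem_iota /= ltnS.
exists u; first by move=> n; apply: BA; case: (Hu n).
apply/(cvg_valueP dE) => y; apply/(cvg_dist dE) => e e0.
have [x /qD[i <-] yx] := Drep y.
have [N HN] := invS_small e0.
exists (maxn i N) => n; rewrite geq_max => /andP[iN /HN]; apply: lt_trans.
rewrite (yx (value p)); last by exists p => //; left.
rewrite (yx (value (u n))); last by exists (u n) => //; right; case: (Hu n).
by case: (Hu n) => _; exact.
Qed.

End OmegaCovers.

(** * Recursion along the countable ordinals *)

Lemma uncountable_set_nat : ~ countable [set: set nat].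
Proof.
move=> c; have [|u _ uT] := countable_range_nat c; first by exists set0.
have [n un] := uT [set n | ~ u n n] I.
have nn : u n n <-> ~ u n n by rewrite {1}un.
have nu : ~ u n n by move=> unn; exact: (nn.1 unn).
exact/nu/nn.
Qed.

(** The elements with countably many predecessors, in a well-order of an
    uncountable type: a copy of the first uncountable ordinal. *)
Lemma omega1_exists : exists (T : choiceType) (lt : T -> T -> Prop) (W : set T),
  [/\ well_founded lt, forall a b, [\/ lt a b, a = b | lt b a],
      forall a b c, lt a b -> lt b c -> lt a c &
   [/\ forall a, W a -> countable [set b | lt b a],
      forall a b, W a -> lt b a -> W b & ~ countable W]].
Proof.
have [T uncT] : exists T : choiceType, ~ countable [set: T].
  by exists (set nat); exact: uncountable_set_nat.
have [le lewo] := well_ordering_principle T.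
have least (A : set T) : A !=set0 -> exists z, A z /\ forall y, A y -> le z y.
  move=> [z0 Az0].
  have [z [[zA lbz] _]] : exists! z, minimum_of le (mem A) z.
    by apply: lewo; exists z0; exact/mem_set.
  exists z; split; first exact/set_mem.
  by move=> y Ay; apply: lbz; exact/mem_set.
have total a b : le a b \/ le b a.
  have [|z [zab zle]] := least [set a; b]; first by exists a; left.
  by case: zab => <-; [left|right]; apply: zle; [right|left].
have lexx a : le a a by case: (total a a).
have anti a b : le a b -> le b a -> a = b.
  move=> ab ba; have [z [_ uz]] : exists! z, minimum_of le (mem [set a; b]) z.
    by apply: lewo; exists a; apply/mem_set; left.
  rewrite -(uz a); last first.
    by split; [apply/mem_set; left|move=> t /set_mem[->|->]].
  by apply: uz; split; [apply/mem_set; right|move=> t /set_mem[->|->]].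
pose lt a b : Prop := ~ le b a.
have trans a b c : lt b a -> lt c b -> lt c a.
  move=> ba cb ac.
  have [|z [zabc zle]] := least [set x | [\/ x = a, x = b | x = c]].
    by exists a; apply: Or31.
  case: zabc => zE; move: zle; rewrite zE => zle.
  - by apply: ba; apply: zle; apply: Or32.
  - by apply: cb; apply: zle; apply: Or33.
  - have ca : le c a by apply: zle; apply: Or31.
    by apply: ba; rewrite (anti _ _ ac ca); apply: zle; apply: Or32.
pose W := [set a | countable [set b | lt b a]].
have Wdown a b : W a -> lt b a -> W b.
  move=> Wa ba; apply: sub_countable Wa; apply: subset_card_le => c /= cb.
  exact: trans ba cb.
exists T, lt, W; split.
- move=> a; apply: contrapT => nacc.
  have [|z [nz zle]] := least [set x | ~ Acc lt x]; first by exists a.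
  apply: nz; constructor => b bz; apply: contrapT => nb.
  exact/bz/zle.
- move=> a b; have [ab|nab] := pselect (lt a b); first exact: Or31.
  have [ba|nba] := pselect (lt b a); first exact: Or33.
  by apply: Or32; apply: anti; apply: contrapT.
- by move=> a b c ab bc; exact: trans bc ab.
- split; [by []|exact: Wdown|move=> cW; apply: uncT].
  suff -> : [set: T] = W by [].
  apply/seteqP; split=> // a _; apply: contrapT => nWa.
  have [|z [nz zle]] := least [set x | ~ W x]; first by exists a.
  apply: nz; apply: sub_countable cW; apply: subset_card_le => b bz.
  by apply: contrapT => nb; exact/bz/zle.
Qed.

(** Choose a step function and iterate it with [Fix]; at each stage the values that
    are not yet defined are filled with [p0], which [Q] cannot see. *)
Lemma well_founded_choice (T P : Type) (lt : T -> T -> Prop) (p0 : P)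
    (Q : T -> (T -> P) -> P -> Prop) : well_founded lt ->
  (forall a f g p, (forall b, lt b a -> f b = g b) -> Q a f p -> Q a g p) ->
  (forall a f, exists p, Q a f p) -> exists f, forall a, Q a f (f a).
Proof.
move=> wf Qext Qex.
have /choice[step Hstep] (af : T * (T -> P)) : exists p, Q af.1 af.2 p.
  exact: Qex.
pose body a (rec : forall b, lt b a -> P) :=
  step (a, fun b => if pselect (lt b a) is left ba then rec b ba else p0).
pose f := Fix wf (fun=> P) body.
exists f => a; rewrite {2}/f Fix_eq -/f; last first.
  move=> x g h gh; congr (step (_, _)); apply: funext => b.
  by case: pselect.
apply: Qext (Hstep (a, _)) => b ba /=.
by case: pselect.
Qed.

Definition tuples (T : eqType) m (Z : set T) : set (seq T) :=
  [set s | size s = m /\ forall x, x \in s -> Z x].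

Lemma finite_tuples (T : eqType) m (s : seq T) : finite_set (tuples m [set` s]).
Proof.
elim: m => [|m IH].
  apply: (@sub_finite_set _ _ [set [::]]); last exact: finite_set1.
  by move=> t [/size0nil].
apply: (@sub_finite_set _ _ ((fun xt => xt.1 :: xt.2) @`
    ([set` s] `*` tuples m [set` s]))).
  move=> [|x t] [] //= [tm] ts; exists (x, t) => //; split=> /=.
    exact/ts/mem_head.
  by split=> // y yt; apply: ts; rewrite in_cons yt orbT.
by apply: finite_image; apply: finite_setX => //; exact: finite_seq.
Qed.

(** * The k-space case *)

Section KSpace.
Variables (R : realType) (X E : topologicalType) (d : E -> E -> R).
Hypothesis dE : metrizes d.
Variable psi : R -> E.
Hypothesis psi_continuous : continuous psi.
Hypothesis psi_inj : injective psi.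
Hypothesis psi_escapes : forall K : set E, compact K ->
  exists N, forall n, (N <= n)%N -> ~ K (psi n%:R).
Variable H : set {ptws X -> E}.
Hypothesis H_baire : H `<=` @baire_functions X E.
Hypothesis H_two_valued : contains_two_valued psi H.

Local Notation zero := (@zero_sets R X).
Local Notation Y := (baire_space R X).
Local Notation hT := (set_type H).

(* the shift by 2 keeps the two values distinct *)
Let lo n := psi n.+2%:R^-1.
Let hi n := psi n.+2%:R.

Lemma lo_neq_hi n : lo n <> hi n.
Proof.
move=> /psi_inj lohi.
have : n.+2%:R^-1 < n.+2%:R :> R.
  apply: (@lt_trans _ _ 1); last by rewrite ltr1n.
  by rewrite invf_lt1 ?ltr0n// ltr1n.
by rewrite lohi ltxx.
Qed.

Definition lo_hi n (h : hT) := forall x, value h x = lo n \/ value h x = hi n.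

Definition low_set n (h : hT) : set X := [set x | value h x = lo n].

(** The two values are at a positive distance, so approximation within that
    distance is equality. *)
Lemma closure_lo_hi n (B : set hT) p : B `<=` lo_hi n -> closure B p ->
  lo_hi n p /\ forall s : seq X,
    exists2 h, B h & forall x, x \in s -> value h x = value p x.
Proof.
move=> Bn /(closure_valueP dE) clB.
have pn : lo_hi n p.
  move=> x; apply: contrapT => /not_orP[xlo xhi].
  pose e := Num.min (d (value p x) (lo n)) (d (value p x) (hi n)).
  have e0 : 0 < e by rewrite lt_min !(dist_gt0 dE).
  have [h Bh /(_ x (mem_head _ _))] := clB [:: x] e e0.
  by rewrite lt_min; case: (Bn h Bh x) => ->; rewrite ltxx ?andbF.
split=> // s; have [h Bh hs] := clB s _ (dist_gt0 dE (@lo_neq_hi n)).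
exists h => // x /hs.
by case: (pn x) => ->; case: (Bn h Bh x) => -> //; rewrite ?(distC dE (hi n)) ltxx.
Qed.

Lemma closure_bigcup_lt (Z : topologicalType) (B : nat -> set Z) N p :
  closure [set h | exists2 n, (n < N)%N & B n h] p ->
  exists2 n, (n < N)%N & closure (B n) p.
Proof.
elim: N => [|N IH].
  by move=> /(_ setT filterT)[h [[]]].
rewrite (_ : [set h | _] = [set h | exists2 n, (n < N)%N & B n h] `|` B N).
  rewrite closureU => -[/IH[n nN cl]|cl]; last by exists N.
  by exists n => //; exact: ltnW.
apply/seteqP; split=> h /=.
  move=> [n]; rewrite ltnS leq_eqVlt => /orP[/eqP ->|nN] Bn; first by right.
  by left; exists n.
by move=> [[n nN Bn]|BN]; [exists n => //; exact: ltnW|exists N].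
Qed.

Section Layers.
Variable S : nat -> set (set X).

Definition layer n : set hT := [set h | lo_hi n h /\ S n (low_set n h)].

(** For nonempty [X] the union of the layers has the constant psi 0 in its closure
    but does not contain it. A compact set meeting infinitely many layers yields the
    first alternative, since the values hi n leave every compact set; a compact
    set meeting finitely many of them, each in a relatively closed set, does not
    witness that the union is not closed. *)
Lemma k_space_layers : k_space hT ->
  (forall (s : seq X) N, exists n Z,
    [/\ (N <= n)%N, zero Z, S n Z & forall x, x \in s -> Z x]) ->
  (exists (n : nat -> nat) (Z : nat -> set X), (forall j, S (n j) (Z j)) /\
    forall x, exists J, forall j, (J <= j)%N -> Z j x) \/
  (exists K n p, [/\ compact K, K p, closure (layer n `&` K) p & ~ layer n p]).
Proof.
move=> kH covS; apply/or_asboolP; rewrite -implyNb; apply/implyP => /asboolPn nb.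
apply/asboolP; apply: contrapT => na; apply: nb.
have [X0|X0] := pselect ([set: X] !=set0); last first.
  have /choice[n /choice[Z HZ]] (j : nat) : exists n Z, S n Z.
    by have [n [Z [_ _ SZ _]]] := covS [::] 0%N; exists n, Z.
  exists n, Z; split=> // x; case: X0; by exists x.
have [x0 _] := X0.
pose A := \bigcup_n layer n.
have [p0 p0E] := constant_value H_two_valued 0.
have clA : closure A p0.
  apply/(closure_valueP dE) => s e e0.
  have : nbhs (0 : R) (psi @^-1` [set y | d (psi 0) y < e]).
    exact: psi_continuous (nbhs_ball_dist dE (psi 0) e0).
  move=> /nbhs_ballP[c /= c0 ce].
  have [N HN] := invS_small c0.
  have [n [Z [Nn zZ SZ sZ]]] := covS s N.
  have [h hE] := two_valued H_two_valued n.+2%:R^-1 n.+2%:R zZ.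
  exists h.
    exists n => //; split.
      by move=> x; have [Zx|nZx] := pselect (Z x); [left|right]; apply hE.
    rewrite (_ : low_set n h = Z)//; apply/seteqP; split=> x /=; last first.
      by move=> Zx; apply: (hE x).1.
    rewrite /low_set /= => hx; apply: contrapT => /(hE x).2.
    by rewrite hx => /lo_neq_hi.
  move=> x /sZ Zx; rewrite p0E (hE x).1//; apply: ce.
  rewrite /ball /= sub0r normrN ger0_norm ?invr_ge0 ?ler0n//.
  by apply: (HN n.+1); exact: leqW.
have nA : ~ A p0.
  move=> [n _ [/(_ x0) + _]]; rewrite p0E => -[/psi_inj|/psi_inj] /eqP.
    by rewrite eq_sym invr_eq0 pnatr_eq0.
  by rewrite eq_sym pnatr_eq0.
have /kH[K cK HK] : ~ closed A by move=> cA; exact/nA/cA.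
have [inf|/existsNP[N HN]] := pselect (forall N, exists2 n, (N <= n)%N &
    (layer n `&` K) !=set0).
  have /choice[n /choice[h Hh]] j : exists n h,
      [/\ (j <= n)%N, layer n h & K h].
    by have [n jn [h [lh Kh]]] := inf j; exists n, h.
  exists n, (fun j => low_set (n j) (h j)); split.
    by move=> j; case: (Hh j) => _ [].
  move=> x; have cKx : compact ((@value X E H)^~ x @` K).
    apply: continuous_compact cK; apply: continuous_subspaceT.
    exact: value_continuous.
  have [M HM] := psi_escapes cKx.
  exists M => j Mj; have [jn [lh _] Kh] := Hh j.
  case: (lh x) => // hx; exfalso; apply: (HM (n j).+2); last first.
    by exists (h j).
  by do 2 apply: leqW; exact: leq_trans jn.
case: HK; exists (closure (A `&` K)); first exact: closed_closure.
apply/seteqP; split=> p [Ap Kp]; split=> //; first by apply: subset_closure.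
have : closure [set h | exists2 n, (n < N)%N & (layer n `&` K) h] p.
  apply: closureS Ap => h [[n _ lh] Kh]; exists n => //.
  by rewrite ltnNge; apply/negP => Nn; apply: HN; exists n => //; exists h.
move=> /closure_bigcup_lt[n _ cl]; exists n => //.
by apply: contrapT => nl; apply: na; exists K, n, p.
Qed.

End Layers.

(** The n-th layer is given by the low sets on which [phi] takes at most n values.
    A limit can be matched on any n+1 tuples, so the layers are closed, and only the
    first alternative of [k_space_layers] is left: the tuples of points are
    exhausted by countably many sets on each of which [phi] takes finitely many
    values. *)
Lemma k_space_countable_values (T : choiceType) m (phi : seq X -> T) :
  k_space hT ->
  (forall s : seq X, exists2 Z, zero Z &
    (forall x, x \in s -> Z x) /\ finite_set (phi @` tuples m Z)) ->
  countable (phi @` tuples m [set: X]).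
Proof.
move=> kH loc.
pose S n : set (set X) := [set Z | forall t : seq (seq X),
  (forall u, u \in t -> tuples m Z u) -> uniq (map phi t) -> (size t <= n)%N].
have [||] := k_space_layers (S := S) kH.
- move=> s N; have [Z zZ [sZ /(finite_seqP _).1[l lE]]] := loc s.
  exists (maxn N (size l)), Z; split=> //; first exact: leq_maxl.
  move=> t tZ ut; apply: leq_trans (leq_maxr _ _).
  rewrite -(size_map phi); apply: uniq_leq_size => // _ /mapP[u ut' ->].
  have : (phi @` tuples m Z) (phi u) by exists u => //; exact: tZ.
  by rewrite lE.
- move=> [n [Z [SZ Zx]]].
  have sub : phi @` tuples m [set: X] `<=` \bigcup_j (phi @` tuples m (Z j)).
    move=> _ [u [um _] <-].
    suff [J HJ] : exists J, forall x, x \in u -> Z J x.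
      by exists J => //; exists u.
    suff [J HJ] : exists J, forall j, (J <= j)%N -> forall x, x \in u -> Z j x.
      by exists J; exact: HJ.
    elim: u {um} => [|x u [J HJ]]; first by exists 0%N.
    have [J' HJ'] := Zx x; exists (maxn J J') => j.
    rewrite geq_max => /andP[Jj Jj'] y; rewrite in_cons => /orP[/eqP ->|].
      exact: HJ'.
    exact: HJ.
  apply: sub_countable (subset_card_le sub) _.
  apply: bigcup_countable => // j _; apply: finite_set_countable.
  apply: contrapT => inf.
  have [b [ub nb bZ]] : exists b : seq T, [/\ uniq b, (n j < size b)%N &
      forall a, a \in b -> (phi @` tuples m (Z j)) a].
    have [B BZ nB] := infinite_set_fset (n j).+1 inf.
    by exists (finmap.enum_fset B); split=> //; exact: finmap.fset_uniq.
  have /choice[g Hg] a : exists u, a \in b -> tuples m (Z j) u /\ phi u = a.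
    have [ab|ab] := boolP (a \in b); last by exists [::].
    by have [u uZ ua] := bZ a ab; exists u.
  have gK : map phi (map g b) = b.
    rewrite -map_comp -[RHS]map_id; apply/eq_in_map => a ab /=.
    by case: (Hg a ab).
  suff : (size (map g b) <= n j)%N by rewrite size_map leqNgt nb.
  apply: SZ; last by rewrite gK.
  by move=> _ /mapP[a ab ->]; case: (Hg a ab).
- move=> [K [n [p [_ _ cl nl]]]]; exfalso; apply: nl.
  have [|pn app] := @closure_lo_hi n _ p _ cl; first by move=> h [[]].
  split=> // t tp ut.
  have [h [[_ Sh] _] hp] := app (flatten t).
  apply: Sh => // u u_t; have [um up] := tp u u_t; split=> // x xu.
  rewrite /low_set /= hp; first exact: up.
  by apply/flattenP; exists u.
Qed.

Section Tightness.
Variables (N : set_system Y) (m n : nat) (K : set hT) (p : hT).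

Definition countably_covered (Z : set X) := exists V : set_system Y,
  [/\ V `<=` N, countable V & forall t, tuples m Z t ->
     exists2 U, V U & forall x, x \in t -> U x].

Let S (_ : nat) := countably_covered.
Let A := layer S n `&` K.

Hypothesis K_compact : compact K.
Hypothesis pA : closure A p.
Hypothesis p_layer : ~ layer S n p.

Lemma layer_lo_hi : A `<=` lo_hi n.
Proof. by move=> h [[]]. Qed.

(** Countably many low sets that contain all tuples from [Z] pass their countable
    covers on to [Z]. *)
Lemma countably_covered_family (C : set hT) (Z : set X) : countable C ->
  C `<=` A -> (forall t, tuples m Z t ->
    exists2 h, C h & forall x, x \in t -> low_set n h x) ->
  countably_covered Z.
Proof.
move=> cC CA CZ.
have /choice[V HV] h : exists V : set_system Y, C h -> [/\ V `<=` N, countable V &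
    forall t, tuples m (low_set n h) t ->
      exists2 U, V U & forall x, x \in t -> U x].
  have [Ch|nCh] := pselect (C h); last by exists set0.
  by have [[_ [V HV]] _] := CA h Ch; exists V.
exists (\bigcup_(h in C) V h); split.
- by move=> U [h Ch]; case: (HV h Ch) => VN _ _; exact: VN.
- by apply: bigcup_countable => // h Ch; case: (HV h Ch).
- move=> t tZ; have [h Ch ht] := CZ t tZ; have [_ _ Vt] := HV h Ch.
  have [U VU tU] := Vt t (conj tZ.1 ht).
  by exists U => //; exists h.
Qed.

Lemma uncovered_tuple (C : set hT) : countable C -> C `<=` A ->
  exists2 t, tuples m (low_set n p) t &
    forall h, C h -> ~ (forall x, x \in t -> low_set n h x).
Proof.
move=> cC CA; apply: contrapT => not.
apply: p_layer; split; first by have [] := closure_lo_hi layer_lo_hi pA.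
apply: (countably_covered_family cC CA) => t tp.
apply: contrapT => noh; apply: not; exists t => // h Ch ht.
by apply: noh; exists h.
Qed.

(** [A] is closed under limits of countable families, and [p] can be matched
    on each finite set; by compactness it can be matched on a countable one. *)
Lemma match_countable (D : set X) : countable D ->
  exists2 h, A h & forall x, D x -> value h x = value p x.
Proof.
move=> cD; have [_ app] := closure_lo_hi layer_lo_hi pA.
have [D0|D0] := pselect (D !=set0); last first.
  have [h Ah _] := app [::]; exists h => // x Dx; case: D0; by exists x.
have [q _ qD] := countable_range_nat cD D0.
have /choice[u Hu] j : exists h, A h /\ forall i, (i <= j)%N ->
    value h (q i) = value p (q i).
  have [h Ah hp] := app [seq q i | i <- iota 0 j.+1].
  exists h; split=> // i ij; apply: hp; apply: map_f.
  by rewrite mem_iota /= ltnS.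
have uA : range u `<=` A by move=> _ [j _ <-]; case: (Hu j).
have [g [Kg clg]] : K `&` cluster (u @ \oo) !=set0.
  by apply: K_compact; exists 0%N => // j _ /=; case: (Hu j) => -[].
have tail J : closure [set h | exists2 j, (J <= j)%N & u j = h] g.
  move=> B gB; apply: clg => //.
  by exists J => // j /= Jj; exists j.
have tailA J : [set h | exists2 j, (J <= j)%N & u j = h] `<=` lo_hi n.
  by move=> _ [j _ <-]; apply: layer_lo_hi; apply: uA; exists j.
exists g; last first.
  move=> x /qD[i <-].
  have [_ /(_ [:: q i])[_ [j ij <-] /(_ _ (mem_head _ _)) <-]] :=
    closure_lo_hi (@tailA i) (tail i).
  by case: (Hu j) => _; exact.
have [gn gapp] := closure_lo_hi (@tailA 0%N) (tail 0%N).
split=> //; split=> //.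
apply: (@countably_covered_family (range u)) => //.
  by apply: sub_countable (card_image_le _ _) _; exact: countableP.
move=> t [_ tg]; have [h [j _ uj] ht] := gapp t; exists h; first by exists j.
by move=> x xt; rewrite /low_set /= ht//; exact: tg.
Qed.

(** Build tuples s_a of low points of [p] and functions f_a in [A], indexed by the
    countable ordinals, such that s_a is contained in no low set of an earlier
    function while f_a agrees with [p] on all the tuples up to s_a. A cluster
    point [q] of the f_a agrees with [p] on every s_a. The first index at which f
    agrees with [q] on a given tuple is therefore a locally constant function, and
    at s_a its value is at least a. *)
Lemma uncovered_limit_not_k_space : ~ k_space hT.
Proof.
move=> kH.
have [T [lt [W [wf tri trans [Wc Wdown ncW]]]]] := omega1_exists.
have irr a : ~ lt a a.
  by elim: (wf a) => {}a _ IH aa; exact: (IH a aa aa).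
pose agree (h g : hT) (t : seq X) := forall x, x \in t -> value h x = value g x.
have [f Hf] : exists f : T -> seq X * hT, forall a, W a ->
    (forall b, lt b a -> A (f b).2) ->
    [/\ tuples m (low_set n p) (f a).1,
        forall b, lt b a -> ~ (forall x, x \in (f a).1 -> low_set n (f b).2 x),
        A (f a).2, agree (f a).2 p (f a).1 &
        forall b, lt b a -> agree (f a).2 p (f b).1].
  apply: (@well_founded_choice _ _ _ ([::], p) (fun a f sh => W a ->
    (forall b, lt b a -> A (f b).2) ->
    [/\ tuples m (low_set n p) sh.1,
        forall b, lt b a -> ~ (forall x, x \in sh.1 -> low_set n (f b).2 x),
        A sh.2, agree sh.2 p sh.1 &
        forall b, lt b a -> agree sh.2 p (f b).1]) wf).
    move=> a f g sh fg Hf Wa gA.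
    have [|h1 h2 h3 h4 h5] := Hf Wa.
      by move=> b ba; rewrite fg//; exact: gA.
    by split=> // b ba; rewrite -fg//; [exact: h2|exact: h5].
  move=> a f.
  have [[Wa fA]|no] := pselect (W a /\ forall b, lt b a -> A (f b).2); last first.
    by exists ([::], p) => Wa fA; case: no.
  have [||s sp snot] := @uncovered_tuple ((fun b => (f b).2) @` [set b | lt b a]).
  - by apply: sub_countable (card_image_le _ _) (Wc a Wa).
  - by move=> _ [b ba <-]; exact: fA.
  have [|h Ah hp] := @match_countable
      ([set` s] `|` \bigcup_(b in [set b | lt b a]) [set` (f b).1]).
    rewrite -bigcup2E; apply: bigcup_countable => // -[|[|k]] _ //=.
    - exact: finite_set_countable (finite_seq _).
    - apply: bigcup_countable; first exact: Wc.
      by move=> b _; exact: finite_set_countable (finite_seq _).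
  exists (s, h) => _ _; split=> //=.
  - by move=> b ba; apply: snot; exists b.
  - by move=> x xs; apply: hp; left.
  - by move=> b ba x xs; apply: hp; right; exists b.
have fA a : W a -> A (f a).2.
  elim: (wf a) => {}a _ IH Wa; have [|_ _ +] := Hf a Wa; last by [].
  by move=> b ba; apply: IH => //; exact: Wdown Wa ba.
have {}Hf a : W a -> [/\ tuples m (low_set n p) (f a).1,
    forall b, lt b a -> ~ (forall x, x \in (f a).1 -> low_set n (f b).2 x) &
    forall b, W b -> ~ lt b a -> agree (f b).2 p (f a).1].
  move=> Wa; have fA' c : W c -> forall b, lt b c -> A (f b).2.
    by move=> Wc' b bc; apply: fA; exact: Wdown Wc' bc.
  have [h1 h2 h3 h4 _] := Hf a Wa (fA' a Wa).
  split=> // b Wb nba; case: (tri a b) => [ab|<-//|//].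
  by have [_ _ _ _] := Hf b Wb (fA' b Wb); exact.
pose tail a := [set h | exists b, [/\ W b, ~ lt b a & (f b).2 = h]].
have tailA a : tail a `<=` A by move=> _ [b [Wb _ <-]]; exact: fA.
have [w0 Ww0] : W !=set0.
  by apply: contrapT => W0; apply: ncW; apply: sub_countable (countable0 T);
    apply: subset_card_le => a Wa; case: W0; exists a.
pose G := filter_from W tail.
have PG : ProperFilter G.
  apply: filter_from_proper; last by move=> a Wa; exists (f a).2, a.
  apply: filter_from_filter; first by exists w0.
  move=> a b Wa Wb.
  have mono c e : ~ lt e c -> tail e `<=` tail c.
    move=> ec _ [b' [Wb' nb' <-]]; exists b'; split=> // b'c.
    case: (tri c e) => [ce|ce|//]; first exact: nb' (trans _ _ _ b'c ce).
    by apply: nb'; rewrite -ce.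
  case: (tri a b) => [ab|<-|ba].
  - exists b => // h hb; split=> //; apply: mono hb => ba.
    exact: irr (trans _ _ _ ab ba).
  - by exists a.
  - exists a => // h ha; split=> //; apply: mono ha => ab.
    exact: irr (trans _ _ _ ab ba).
have [q [Kq clq]] : K `&` cluster G !=set0.
  by apply: K_compact; exists w0 => // _ [b [Wb _ <-]]; case: (fA b Wb).
have tailq a : W a -> forall s : seq X,
    exists b, [/\ W b, ~ lt b a & agree (f b).2 q s].
  move=> Wa s; have cl : closure (tail a) q.
    by move=> B qB; apply: clq => //; exists a.
  have [|_ /(_ s)[_ [b [Wb ba <-]] bq]] := @closure_lo_hi n (tail a) q _ cl.
    exact: subset_trans (@tailA a) layer_lo_hi.
  by exists b.
have qp a : W a -> agree q p (f a).1.
  move=> Wa x xa; have [b [Wb ba bq]] := tailq a Wa (f a).1.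
  by rewrite -bq//; have [_ _ /(_ b Wb ba)] := Hf a Wa; exact.
have /choice[phi Hphi] (t : seq X) : exists a, [/\ W a, agree (f a).2 q t &
    forall b, W b -> agree (f b).2 q t -> ~ lt b a].
  have [c [Wcc _ cq]] := tailq w0 Ww0 t.
  elim: (wf c) Wcc cq => {}c _ IH Wcc cq.
  have [[b [Wb bc bq]]|no] :=
    pselect (exists b, [/\ W b, lt b c & agree (f b).2 q t]); first exact: IH bq.
  by exists c; split=> // b Wb bq bc; apply: no; exists b.
have cle a : W a -> countable [set b | ~ lt a b].
  move=> Wa; apply: (@sub_countable _ _ _ ([set b | lt b a] `|` [set a])).
    apply: subset_card_le => b /= nab.
    by case: (tri a b) => [//|->|ba]; [right|left].
  rewrite -bigcup2E; apply: bigcup_countable => // -[|[|k]] _ //=.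
  exact: Wc.
(* phi is determined by the joint fibres of q and of the f_b for b up to the
   finitely many values that phi takes on tuples from s *)
have cphi : countable (phi @` tuples m [set: X]).
  apply: k_space_countable_values => // s.
  pose D := phi @` tuples m [set` s].
  have finD : finite_set D by apply: finite_image; exact: finite_tuples.
  pose I := \bigcup_(a in D) [set b | ~ lt a b].
  have cI : countable I.
    apply: bigcup_countable; first exact: finite_set_countable.
    by move=> _ [t _ <-]; apply: cle; case: (Hphi t).
  pose C := (fun b => value (f b).2) @` I `|` [set value q].
  have cC : countable C.
    rewrite /C -bigcup2E; apply: bigcup_countable => // -[|[|k]] _ //=.
    by apply: sub_countable (card_image_le _ _) _.
  have CB : C `<=` @baire_functions X E.
    by move=> _ [[b _ <-]|->]; exact: H_baire (set_valP _).
  have /choice[Z HZ] x : exists Z, zero Z /\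
      (Z x /\ forall y, Z y -> forall h, C h -> h y = h x).
    by have [Z zZ HZ] := baire_functions_fibre dE x cC CB; exists Z.
  exists [set y | exists2 x, x \in s & Z x y].
    by apply: zero_set_bigcup => x _; case: (HZ x).
  split; first by move=> x xs; exists x => //; case: (HZ x) => _ [].
  apply: sub_finite_set finD => _ [t [tm tZ] <-].
  have /choice[r Hr] y : exists x, y \in t -> x \in s /\ Z x y.
    have [yt|yt] := boolP (y \in t); last by exists y.
    by have [x xs Zxy] := tZ y yt; exists x.
  have rC h y : C h -> y \in t -> h y = h (r y).
    by move=> Ch yt; have [_] := Hr y yt; have [_ [_ HZy]] := HZ (r y) => /HZy; exact.
  have rs : tuples m [set` s] (map r t).
    split; first by rewrite size_map.
    by move=> _ /mapP[y yt ->]; case: (Hr y yt).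
  have Cq : C (value q) by right.
  have agree_r b : I b -> agree (f b).2 q t <-> agree (f b).2 q (map r t).
    move=> Ib; have Cb : C (value (f b).2) by left; exists b.
    split=> [bq _ /mapP[y yt ->]|bq y yt].
      by rewrite -(rC _ _ Cb yt) -(rC _ _ Cq yt); exact: bq.
    by rewrite (rC _ _ Cb yt) (rC _ _ Cq yt); apply: bq; exact: map_f.
  have [Wt tq tmin] := Hphi t; have [Wr rq rmin] := Hphi (map r t).
  have Dr : D (phi (map r t)) by exists (map r t).
  have Ir : I (phi (map r t)) by exists (phi (map r t)) => //; exact: irr.
  have nrt : ~ lt (phi (map r t)) (phi t) by apply: tmin => //; apply/agree_r.
  have It : I (phi t) by exists (phi (map r t)).
  have ntr : ~ lt (phi t) (phi (map r t)) by apply: rmin => //; apply/agree_r.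
  by case: (tri (phi t) (phi (map r t))) => [//|->//|//].
(* W is covered by the initial segments up to the values of phi *)
apply: ncW; apply: (@sub_countable _ _ _
    (\bigcup_(a in phi @` tuples m [set: X]) [set b | ~ lt a b])); last first.
  apply: bigcup_countable => // _ [t _ <-]; apply: cle; by case: (Hphi t).
apply: subset_card_le => a Wa; exists (phi (f a).1).
  by exists (f a).1 => //; have [[sm _] _ _] := Hf a Wa.
move=> pa; have [_ aq _] := Hphi (f a).1; have [[_ sp] snot _] := Hf a Wa.
apply: (snot _ pa) => x xa.
by rewrite /low_set /= (aq x xa) (qp a Wa x xa); exact: sp.
Qed.

End Tightness.

Lemma k_space_omega_subcovers : k_space hT -> countable_omega_subcovers R X.
Proof.
move=> kH N oN covN.
have /choice[V HV] m : countably_covered N m [set: X].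
  have [||] := k_space_layers (S := fun=> countably_covered N m) kH.
  - move=> s n; have [U NU sU] := (omega_cover_seqP N).1 covN s.
    have [Z zZ [sZ ZU]] := open_baire_seq (oN U NU) sU.
    exists n, Z; split=> //; exists [set U]; split.
    + by move=> _ ->.
    + exact: countable1.
    + by move=> t [_ tZ]; exists U => // x /tZ; exact: ZU.
  - move=> [n [Z [/choice[V HV] Zx]]]; exists (\bigcup_j V j); split.
    + by move=> U [j _ VU]; have [+ _ _] := HV j; exact.
    + by apply: bigcup_countable => // j _; case: (HV j).
    + move=> t [tm _].
      suff [J HJ] : exists J, forall j, (J <= j)%N -> forall x, x \in t -> Z j x.
        have [_ _ Vt] := HV J; have [U VU tU] := Vt t (conj tm (HJ J (leqnn J))).
        by exists U => //; exists J.
      elim: t {tm} => [|x t [J HJ]]; first by exists 0%N.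
      have [J' HJ'] := Zx x; exists (maxn J J') => j.
      rewrite geq_max => /andP[Jj Jj'] y; rewrite in_cons => /orP[/eqP ->|].
        exact: HJ'.
      exact: HJ.
  - move=> [K [n [p [cK Kp cl nl]]]]; exfalso.
    exact: (uncovered_limit_not_k_space cK cl nl kH).
exists (\bigcup_m V m); split.
- by move=> U [m _ VU]; have [+ _ _] := HV m; exact.
- by apply: bigcup_countable => // m _; case: (HV m).
- apply/omega_cover_seqP => s; have [_ _ Vs] := HV (size s).
  have [//|U VU sU] := Vs s; exists U => //; by exists (size s).
Qed.

End KSpace.

(** * Scalars and rays *)

Lemma real_scalars (R : realType) (c : bool) :
  exists iota : {rmorphism R -> scalar_field R c}, continuous iota.
Proof.
case: c; last by exists idfun => x; exact: cvg_id.
exists (real_complex R : {rmorphism R -> R[i]}) => x.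
apply/(@cvgrPdist_lt R[i] R[i]^o) => e e0.
have eE : e = (complex.Re e)%:C%C.
  by apply/eqP; rewrite eq_complex /= eqxx; move: e0; rewrite ltcE /= => /andP[].
have e0' : 0 < complex.Re e by rewrite -ltcR -eE.
have near_x : nbhs (x : R) (ball (x : R) (complex.Re e)) by exact: nbhsx_ballx.
apply: filterS near_x => y /=; rewrite /ball /= => xy.
rewrite -rmorphB /= eE.
by rewrite normc_def /= expr0n addr0 sqrtr_sqr ltcR.
Qed.

Section Ray.
Variables (R : realType) (c : bool) (E : tvsType (scalar_field R c)).
Variable d : E -> E -> R.
Hypothesis dE : metrizes d.
Variable iota : {rmorphism R -> scalar_field R c}.
Hypothesis iota_continuous : continuous iota.
Variable v : E.
Hypothesis v0 : v <> 0.

Definition ray (t : R) : E := iota t *: v.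

Lemma ray_continuous : continuous ray.
Proof.
move=> t; rewrite /ray.
apply: (@continuous2_cvg _ _ _ _ _ _ (iota : R -> (scalar_field R c)^o) (fun=> v)
  (fun a u => a *: u) (iota t) v).
- exact: (@scale_continuous _ E (iota t, v)).
- exact: iota_continuous.
- exact: cvg_cst.
Qed.

Lemma ray_inj : injective ray.
Proof.
move=> s t /eqP; rewrite /ray -subr_eq0 -scalerBl scaler_eq0 => /orP[|/eqP//].
by rewrite -rmorphB fmorph_eq0 subr_eq0 => /eqP.
Qed.

(** A cluster point w of the vectors n v would give v = n^-1 (n v) -> 0 w = 0. *)
Lemma ray_escapes (K : set E) : compact K ->
  exists N, forall n, (N <= n)%N -> ~ K (ray n%:R).
Proof.
move=> cK; apply: contrapT => noN.
have /choice[n Hn] j : exists n, (j <= n)%N /\ K (ray n%:R).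
  apply: contrapT => no; apply: noN; exists j => n jn Kn; apply: no.
  by exists n.
have [w [Kw clw]] : K `&` cluster ((fun j => ray (n j)%:R) @ \oo) !=set0.
  by apply: cK; exists 0%N => // j _ /=; case: (Hn j).
have dv : 0 < d 0 v by apply: (dist_gt0 dE) => /esym.
have := @scale_continuous _ E (0, w); rewrite /continuous_at /= scale0r.
move=> /(_ _ (nbhs_ball_dist dE 0 dv))[[A B] /= [A0 Bw] AB].
have : nbhs (0 : R) (iota @^-1` A) by apply: iota_continuous; rewrite rmorph0.
move=> /nbhs_ballP[e /= e0 eA]; have [J HJ] := invS_small e0.
have [_ [[j [Jj <-]] Bj]] : ((fun j => ray (n j)%:R) @` [set j | (J < j)%N]) `&` B !=set0.
  by apply: clw => //; exists J.+1 => // j /= Jj; exists j.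
have nj : (J < n j)%N by apply: leq_trans Jj _; case: (Hn j).
have nj0 : (n j)%:R != 0 :> R by rewrite pnatr_eq0 -lt0n; apply: leq_ltn_trans nj.
have An : A (iota (n j)%:R^-1).
  apply: eA; rewrite /ball /= sub0r normrN ger0_norm ?invr_ge0 ?ler0n//.
  by rewrite -(ltn_predK nj); apply: HJ; rewrite -ltnS (ltn_predK nj).
have /= := AB (iota (n j)%:R^-1, ray (n j)%:R) (conj An Bj).
by rewrite /ray scalerA -rmorphM mulVf// rmorph1 scale1r ltxx.
Qed.

End Ray.

Theorem theorem5p23 (R : realType) (c : bool)
    (E : tvsType (scalar_field R c)) (X : topologicalType)
    (H : set {ptws X -> E})
    (E_metrizable : metrizable E R) (E_nontrivial : exists v : E, v <> 0)
    (X_tychonoff : tychonoff_space X)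
    (H_baire : H `<=` @baire_functions X E)
    (H_stable : @stable_baire1_rc X E `<=` H) :
  [<-> metrizable (set_type H) R;
       sigma_space (set_type H);
       countable_cs_star_character (set_type H);
       countable [set: X]] /\
  [<-> frechet_urysohn_space (set_type H);
       sequential_space (set_type H);
       k_space (set_type H);
       countable_tightness (set_type H);
       gamma_property (baire_space R X)].
Proof.
case: E_metrizable => d dE; case: E_nontrivial => v v0.
have [iota iotac] := real_scalars R c.
have psic := @ray_continuous R c E iota iotac v.
have psii := @ray_inj R c E iota v v0.
have psie := @ray_escapes R c E d dE iota iotac v v0.
have H2 : contains_two_valued (ray iota v) H.
  by move=> A a b zA; apply: H_stable; exact: (two_valued_stable dE psic).
have c_metr : countable [set: X] -> metrizable (set_type H) R.
  exact: metrizable_pointwise dE H.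
have metr_sigma : metrizable (set_type H) R -> sigma_space (set_type H).
  by move=> [D HD]; exact: metrizable_sigma_space HD.
have sigma_c := sigma_space_countable dE psii X_tychonoff H2.
split; tfae.
- exact: metr_sigma.
- by move=> /sigma_c/c_metr[D HD]; exact: metrizable_cs_star HD.
- exact: (cs_star_countable dE psii X_tychonoff H2).
- exact: c_metr.
- exact: frechet_urysohn_sequential.
- exact: sequential_k_space.
- move=> /(k_space_omega_subcovers dE psic psii psie H_baire H2) Lin.
  exact/frechet_urysohn_tight/(omega_subcovers_frechet_urysohn dE H_baire).
- move=> /(tight_omega_subcovers dE psii H2) Lin.
  exact: (omega_subcovers_gamma dE psii H_baire H2).
- move=> /gamma_omega_subcovers Lin.
  exact: (omega_subcovers_frechet_urysohn dE H_baire Lin).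
Qed.
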